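(* For every set $K\subset\mathbb{R}^n$ that is the support of an absolutely decaying measure there exists $\alpha=\alpha(K)>0$ such that for every $m\in\mathbb{N}$ and every $A\in\operatorname{M}_{n\times m}(\mathbb{R})$, the set $$\mathbf{Bad}_A(n,m)=\Big\{\mathbf{x}\in\mathbb{R}^n:\ \inf_{\mathbf{q}\in\mathbb{Z}^m\setminus\{0\}}\|\mathbf{q}\|^{m/n}\,d(A\mathbf{q}-\mathbf{x},\mathbb{Z}^n)>0\Big\}$$ is $\alpha$-winning on $K$.
   Context: $d$ is Euclidean distance and $d(\mathbf{v},\mathbb{Z}^n)=\min_{\mathbf{p}\in\mathbb{Z}^n}d(\mathbf{v},\mathbf{p})$. For a closed set $K\subset\mathbb{R}^n$ and $0<\alpha,\beta<1$, Schmidt's $(\alpha,\beta)$-game on $K$ with target set $S$: balls are $B(\mathbf{x},\rho)=\{\mathbf{x}'\in K: d(\mathbf{x},\mathbf{x}')\le\rho\}$ with $\mathbf{x}\in K$, $\rho>0$, and $(\mathbf{x}_2,\rho_2)\le_s(\mathbf{x}_1,\rho_1)$ means $\rho_2+d(\mathbf{x}_1,\mathbf{x}_2)\le\rho_1$. Bob picks $\omega_1=(\mathbf{x}_1,\rho_1)$; then Alice and Bob alternately pick $\omega_k'=(\mathbf{x}_k',\rho_k')\le_s\omega_k$ and $\omega_{k+1}\le_s\omega_k'$, centers in $K$, with $\rho_k'=\alpha\rho_k$, $\rho_{k+1}=\beta\rho_k'$. The nested balls intersect in one point $\mathbf{x}_\infty$; Alice wins if $\mathbf{x}_\infty\in S$.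 $S$ is $(\alpha,\beta)$-winning on $K$ if Alice has a strategy guaranteeing $\mathbf{x}_\infty\in S\cap K$, and $\alpha$-winning on $K$ if this holds for every $\beta\in(0,1)$. A locally finite Borel measure $\mu$ on $\mathbb{R}^n$ is $(C,\gamma)$-absolutely decaying ($C,\gamma>0$) if there is $\rho_0>0$ with $\mu(B(\mathbf{x},\rho)\cap\mathcal L^{(\varepsilon)})<C(\varepsilon/\rho)^\gamma\mu(B(\mathbf{x},\rho))$ for every affine hyperplane $\mathcal L$, $\mathbf{x}\in\operatorname{supp}\mu$, $0<\rho<\rho_0$, $\varepsilon>0$ (closed Euclidean balls; $\mathcal L^{(\varepsilon)}$ the closed $\varepsilon$-neighborhood of $\mathcal L$); $\mu$ is absolutely decaying if it is $(C,\gamma)$-absolutely decaying for some $C,\gamma>0$. *)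

(* Defs.v *)
From Stdlib Require Import Reals Lra List.
From Stdlib Require Fin.
Open Scope R_scope.

Fixpoint sumFin (n : nat) : (Fin.t n -> R) -> R :=
  match n return (Fin.t n -> R) -> R with
  | O => fun _ => 0
  | S m => fun f => f Fin.F1 + sumFin m (fun i => f (Fin.FS i))
  end.

Definition Vec (n : nat) := Fin.t n -> R.

Definition dist {n : nat} (x y : Vec n) : R :=
  sqrt (sumFin n (fun i => (x i - y i) ^ 2)).

Definition dot {n : nat} (a x : Vec n) : R := sumFin n (fun i => a i * x i).

Definition znorm {m : nat} (q : Fin.t m -> Z) : R :=
  sqrt (sumFin m (fun j => (IZR (q j)) ^ 2)).

Definition matZ {n m : nat} (A : Fin.t n -> Fin.t m -> R) (q : Fin.t m -> Z)
  : Vec n := fun i => sumFin m (fun j => A i j * IZR (q j)).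

(* d(v, Z^n) = min over p in Z^n of d(v,p); we use it only through
   lower bounds:  c <= d(v,Z^n)  iff  forall p, c <= d(v,p). *)
Definition dist_Zn_ge {n : nat} (v : Vec n) (c : R) : Prop :=
  forall p : Fin.t n -> Z, c <= dist v (fun i => IZR (p i)).

Definition Bad (n m : nat) (A : Fin.t n -> Fin.t m -> R) (x : Vec n) : Prop :=
  exists c : R, 0 < c /\
    forall q : Fin.t m -> Z, (exists j, q j <> 0%Z) ->
      forall p : Fin.t n -> Z,
        c <= Rpower (znorm q) (INR m / INR n) *
             dist (fun i => matZ A q i - x i) (fun i => IZR (p i)).

Definition is_open {n : nat} (U : Vec n -> Prop) : Prop :=
  forall x, U x -> exists r, 0 < r /\ forall y, dist x y < r -> U y.

Definition is_closed {n : nat} (K : Vec n -> Prop) : Prop :=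
  is_open (fun x => ~ K x).

Inductive is_borel {n : nat} : (Vec n -> Prop) -> Prop :=
  | borel_open : forall U, is_open U -> is_borel U
  | borel_compl : forall A, is_borel A -> is_borel (fun x => ~ A x)
  | borel_union : forall F : nat -> Vec n -> Prop,
      (forall k, is_borel (F k)) -> is_borel (fun x => exists k, F k x).

Inductive ER : Type := ERfin (r : R) | ERinf.

Definition ERle (a b : ER) : Prop :=
  match a, b with
  | _, ERinf => True
  | ERinf, ERfin _ => False
  | ERfin x, ERfin y => x <= y
  end.

Definition ERlt (a b : ER) : Prop :=
  match a, b with
  | ERfin x, ERfin y => x < y
  | ERfin _, ERinf => True
  | ERinf, _ => False
  end.

Definition ERplus (a b : ER) : ER :=
  match a, b with
  | ERfin x, ERfin y => ERfin (x + y)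
  | _, _ => ERinf
  end.

(* multiplication by a positive real scalar *)
Definition ERscale (c : R) (a : ER) : ER :=
  match a with ERfin x => ERfin (c * x) | ERinf => ERinf end.

Fixpoint ERpsum (f : nat -> ER) (N : nat) : ER :=
  match N with
  | O => ERfin 0
  | S N' => ERplus (ERpsum f N') (f N')
  end.

Definition is_ER_sup (P : ER -> Prop) (s : ER) : Prop :=
  (forall y, P y -> ERle y s) /\
  (forall z, (forall y, P y -> ERle y z) -> ERle s z).

(* mu is a (positive, countably additive) Borel measure on R^n;
   its values on non-Borel sets are irrelevant. *)
Definition is_borel_measure {n : nat} (mu : (Vec n -> Prop) -> ER) : Prop :=
  mu (fun _ => False) = ERfin 0 /\
  (forall A, is_borel A -> ERle (ERfin 0) (mu A)) /\
  (forall F : nat -> Vec n -> Prop,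
     (forall k, is_borel (F k)) ->
     (forall i j x, i <> j -> F i x -> F j x -> False) ->
     is_ER_sup (fun s => exists N, s = ERpsum (fun k => mu (F k)) N)
               (mu (fun x => exists k, F k x))).

Definition cball {n : nat} (x : Vec n) (rho : R) : Vec n -> Prop :=
  fun y => dist x y <= rho.

Definition locally_finite {n : nat} (mu : (Vec n -> Prop) -> ER) : Prop :=
  forall x, exists r, 0 < r /\ mu (cball x r) <> ERinf.

Definition supp {n : nat} (mu : (Vec n -> Prop) -> ER) : Vec n -> Prop :=
  fun x => forall r, 0 < r -> ERlt (ERfin 0) (mu (cball x r)).

Definition hyperplane {n : nat} (a : Vec n) (b : R) : Vec n -> Prop :=
  fun y => dot a y = b.

Definition nbhd {n : nat} (L : Vec n -> Prop) (eps : R) : Vec n -> Prop :=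
  fun y => exists z, L z /\ dist y z <= eps.

Definition abs_decaying_CG {n : nat} (mu : (Vec n -> Prop) -> ER)
  (C gam : R) : Prop :=
  exists rho0, 0 < rho0 /\
    forall (a : Vec n) (b : R), (exists i, a i <> 0) ->
    forall x, supp mu x ->
    forall rho, 0 < rho -> rho < rho0 ->
    forall eps, 0 < eps ->
      ERlt (mu (fun y => cball x rho y /\ nbhd (hyperplane a b) eps y))
           (ERscale (C * Rpower (eps / rho) gam) (mu (cball x rho))).

Definition abs_decaying {n : nat} (mu : (Vec n -> Prop) -> ER) : Prop :=
  exists C gam, 0 < C /\ 0 < gam /\ abs_decaying_CG mu C gam.

Definition Ball (n : nat) := (Vec n * R)%type.

Definition in_ball {n : nat} (K : Vec n -> Prop) (w : Ball n) (y : Vec n) : Prop :=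
  K y /\ dist (fst w) y <= snd w.

Definition ball_le {n : nat} (w2 w1 : Ball n) : Prop :=
  snd w2 + dist (fst w1) (fst w2) <= snd w1.

(* an Alice strategy maps the list of Bob's moves so far
   [omega_1; ...; omega_k] to Alice's move omega_k' *)
Definition Strategy (n : nat) := list (Ball n) -> Ball n.

Definition bob_prefix {n : nat} (b : nat -> Ball n) (k : nat) : list (Ball n) :=
  map b (seq 0 (S k)).

(* Alice's k-th move (0-indexed) against Bob's sequence b *)
Definition alice_move {n : nat} (s : Strategy n) (b : nat -> Ball n) (k : nat)
  : Ball n := s (bob_prefix b k).

Definition bob_legal {n : nat} (K : Vec n -> Prop) (beta : R) (s : Strategy n)
  (b : nat -> Ball n) (k : nat) : Prop :=
  match k with
  | O => K (fst (b O)) /\ 0 < snd (b O)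
  | S k' => K (fst (b k)) /\ snd (b k) = beta * snd (alice_move s b k')
            /\ ball_le (b k) (alice_move s b k')
  end.

Definition alice_legal {n : nat} (K : Vec n -> Prop) (alpha : R) (s : Strategy n)
  (b : nat -> Ball n) (k : nat) : Prop :=
  K (fst (alice_move s b k)) /\ snd (alice_move s b k) = alpha * snd (b k)
  /\ ball_le (alice_move s b k) (b k).

Definition ab_winning {n : nat} (K S : Vec n -> Prop) (alpha beta : R) : Prop :=
  exists s : Strategy n, forall b : nat -> Ball n,
    (forall k, (forall j, (j <= k)%nat -> bob_legal K beta s b j) ->
               alice_legal K alpha s b k) /\
    ((forall k, bob_legal K beta s b k) ->
     forall y, (forall k, in_ball K (b k) y) -> S y /\ K y).

Definition alpha_winning {n : nat} (K S : Vec n -> Prop) (alpha : R) : Prop :=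
  forall beta, 0 < beta < 1 -> ab_winning K S alpha beta.

(* Main.v *)
From Stdlib Require Import Reals Lra Lia ZArith Arith List.
From Stdlib Require Import Classical ClassicalEpsilon FunctionalExtensionality PropExtensionality.
From Stdlib Require Cantor FinFun.
From Stdlib Require Fin.
Require Import Defs.
Open Scope R_scope.

(** For every dyadic shell [2^(j-1) <= |y|_oo <= 2^j] of [Z^n], let [z_j] be the vector of the shell
    that best approximates, i.e. makes [A^T y] closest to [Z^m].  By Dirichlet's theorem, for every
    [q] there is some [j] with [2^j] of order at most [|q|^(m/n)] for which [|q| d(A^T z_j, Z^m)] is
    small, and the identity
      [z_j . x - (integer) = q . (A^T z_j - P) - z_j . (A q - x - p)]
    shows that [x] lies in [Bad_A] as soon as all the [z_j . x] stay a distance [delta] away from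
    the integers.

    In a ball of radius [rho] at most one hyperplane [z_j . y = p] matters for each [j] with
    [2^j rho] small.  Alice gives such a hyperplane, as long as it is near the ball, the weight
    [(2^j rho)^(-s)], where [s] is chosen so that weights double at each turn.  Since the measure of
    the neighbourhood of each hyperplane is a small proportion of the measure of the ball, averaging
    over the measure produces a point of the support that is near hyperplanes of at most a quarter
    of the total weight.  So the total weight is halved at each turn, up to the boundedly many
    hyperplanes that become relevant, hence it stays bounded: every hyperplane is avoided at
    a scale comparable to [2^(-j)].  How much must be discarded at one turn does not depend on
    [beta], and this is why neither does [alpha]. *)

(** * Finite sums and Euclidean geometry *)

Lemma sumFin_ext (n : nat) (f g : Fin.t n -> R) :
  (forall i, f i = g i) -> sumFin n f = sumFin n g.
Proof.
  intros H; f_equal; extensionality i; apply H.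
Qed.

Lemma sumFin_le (n : nat) (f g : Fin.t n -> R) :
  (forall i, f i <= g i) -> sumFin n f <= sumFin n g.
Proof.
  induction n as [|n IH]; simpl; intros H; [lra|].
  apply Rplus_le_compat; [apply H | apply IH; intros i; apply H].
Qed.

Lemma sumFin_plus (n : nat) (f g : Fin.t n -> R) :
  sumFin n (fun i => f i + g i) = sumFin n f + sumFin n g.
Proof.
  induction n as [|n IH]; simpl; [lra|].
  rewrite (IH (fun i => f (Fin.FS i)) (fun i => g (Fin.FS i))); lra.
Qed.

Lemma sumFin_scal (n : nat) (c : R) (f : Fin.t n -> R) :
  sumFin n (fun i => c * f i) = c * sumFin n f.
Proof.
  induction n as [|n IH]; simpl; [lra|].
  rewrite (IH (fun i => f (Fin.FS i))); lra.
Qed.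

Lemma sumFin_const (n : nat) (c : R) : sumFin n (fun _ => c) = INR n * c.
Proof.
  induction n as [|n IH]; [simpl; lra|].
  rewrite S_INR; simpl; rewrite IH; lra.
Qed.

Lemma sumFin_nonneg (n : nat) (f : Fin.t n -> R) :
  (forall i, 0 <= f i) -> 0 <= sumFin n f.
Proof.
  intros H; pose proof (sumFin_le n (fun _ => 0) f H) as H0.
  rewrite sumFin_const in H0; lra.
Qed.

Lemma sumFin_ge_term (n : nat) (f : Fin.t n -> R) (i : Fin.t n) :
  (forall i, 0 <= f i) -> f i <= sumFin n f.
Proof.
  intros Hf; induction i as [n|n i IH]; simpl.
  - pose proof (sumFin_nonneg n (fun i => f (Fin.FS i)) (fun i => Hf _)); lra.
  - pose proof (IH (fun i => f (Fin.FS i)) (fun i => Hf _)); pose proof (Hf Fin.F1).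
    simpl in *; lra.
Qed.

Lemma sumFin_swap (n m : nat) (f : Fin.t n -> Fin.t m -> R) :
  sumFin n (fun i => sumFin m (f i)) = sumFin m (fun j => sumFin n (fun i => f i j)).
Proof.
  induction n as [|n IH]; simpl.
  - rewrite sumFin_const; lra.
  - rewrite (IH (fun i => f (Fin.FS i))), sumFin_plus; reflexivity.
Qed.

Lemma sumFin_IZR (n : nat) (f : Fin.t n -> Z) :
  exists N : Z, sumFin n (fun i => IZR (f i)) = IZR N.
Proof.
  induction n as [|n IH]; simpl; [exists 0%Z; reflexivity|].
  destruct (IH (fun i => f (Fin.FS i))) as [N HN].
  exists (f Fin.F1 + N)%Z; rewrite HN, plus_IZR; reflexivity.
Qed.

Lemma Rabs_le_inv (x a : R) : Rabs x <= a -> - a <= x <= a.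
Proof.
  intros H; pose proof (Rle_abs x); pose proof (Rle_abs (- x)) as H1.
  rewrite Rabs_Ropp in H1; lra.
Qed.

Lemma Rabs_sumFin_le (n : nat) (f : Fin.t n -> R) (c : R) :
  (forall i, Rabs (f i) <= c) -> Rabs (sumFin n f) <= INR n * c.
Proof.
  intros H; rewrite <- sumFin_const.
  apply Rabs_le; split.
  - replace (- sumFin n (fun _ => c)) with (sumFin n (fun _ => (-1) * c))
      by (rewrite sumFin_scal; ring).
    apply sumFin_le; intros i; specialize (H i); apply Rabs_le_inv in H; lra.
  - apply sumFin_le; intros i; specialize (H i); apply Rabs_le_inv in H; lra.
Qed.

Definition norm {n : nat} (x : Vec n) : R := sqrt (sumFin n (fun i => x i ^ 2)).

Lemma sumsq_nonneg (n : nat) (x : Vec n) : 0 <= sumFin n (fun i => x i ^ 2).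
Proof. apply sumFin_nonneg; intros i; apply pow2_ge_0. Qed.

Lemma norm_nonneg (n : nat) (x : Vec n) : 0 <= norm x.
Proof. apply sqrt_pos. Qed.

Lemma norm_sqr (n : nat) (x : Vec n) : norm x * norm x = sumFin n (fun i => x i ^ 2).
Proof. apply sqrt_sqrt, sumsq_nonneg. Qed.

Lemma dist_norm (n : nat) (x y : Vec n) : dist x y = norm (fun i => x i - y i).
Proof. reflexivity. Qed.

Lemma norm_ge_coord (n : nat) (x : Vec n) (i : Fin.t n) : Rabs (x i) <= norm x.
Proof.
  unfold norm; rewrite <- (sqrt_Rsqr_abs (x i)).
  apply sqrt_le_1_alt.
  replace (Rsqr (x i)) with (x i ^ 2) by (unfold Rsqr; ring).
  apply (sumFin_ge_term n (fun i => x i ^ 2)); intros j; apply pow2_ge_0.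
Qed.

Lemma norm_le_coord (n : nat) (x : Vec n) (c : R) :
  0 <= c -> (forall i, Rabs (x i) <= c) -> norm x <= INR n * c.
Proof.
  intros Hc H; unfold norm.
  assert (HN : 0 <= INR n) by apply pos_INR.
  rewrite <- (sqrt_Rsqr (INR n * c)) by nra.
  apply sqrt_le_1_alt, Rle_trans with (sumFin n (fun _ => c ^ 2)).
  - apply sumFin_le; intros i; rewrite <- (pow2_abs (x i)).
    apply pow_incr; split; [apply Rabs_pos | apply H].
  - rewrite sumFin_const; unfold Rsqr.
    destruct n as [|n]; [simpl; lra|].
    assert (1 <= INR (S n)) by (rewrite S_INR; pose proof (pos_INR n); lra).
    nra.
Qed.

Lemma dot_sqr_le (n : nat) (x y : Vec n) :
  dot x y ^ 2 <= sumFin n (fun i => x i ^ 2) * sumFin n (fun i => y i ^ 2).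
Proof.
  set (a := sumFin n (fun i => x i ^ 2)); set (b := sumFin n (fun i => y i ^ 2)).
  assert (Ha : 0 <= a) by apply sumsq_nonneg.
  assert (Hb : 0 <= b) by apply sumsq_nonneg.
  assert (Q : forall s t, 0 <= s ^ 2 * a + 2 * s * t * dot x y + t ^ 2 * b).
  { intros s t.
    replace (s ^ 2 * a + 2 * s * t * dot x y + t ^ 2 * b)
      with (sumFin n (fun i => (s * x i + t * y i) ^ 2)).
    - apply (sumsq_nonneg n (fun i => s * x i + t * y i)).
    - unfold a, b, dot; rewrite <- !sumFin_scal, <- !sumFin_plus.
      apply sumFin_ext; intros i; ring. }
  (* The first instance reads [b * (a * b - dot x y ^ 2) >= 0] and settles [b > 0]. For [b = 0] the
     second reads [- (a + 2) * dot x y ^ 2 >= 0], forcing [dot x y = 0]. *)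
  pose proof (Q b (- dot x y)) as Q1.
  pose proof (Q (dot x y) (- (a + 1))) as Q2.
  destruct (Rle_lt_or_eq_dec 0 b Hb) as [Hb'|Hb']; [|rewrite <- Hb' in *; nra].
  assert (0 <= b * (a * b - dot x y ^ 2)) by nra.
  apply Rnot_lt_le; intros Hlt.
  assert (0 < b * (dot x y ^ 2 - a * b)) by (apply Rmult_lt_0_compat; lra).
  lra.
Qed.

Lemma Cauchy_Schwarz (n : nat) (x y : Vec n) : Rabs (dot x y) <= norm x * norm y.
Proof.
  unfold norm; rewrite <- sqrt_mult by apply sumsq_nonneg.
  rewrite <- sqrt_Rsqr_abs; apply sqrt_le_1_alt.
  replace (Rsqr (dot x y)) with (dot x y ^ 2) by (unfold Rsqr; ring).
  apply dot_sqr_le.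
Qed.

Lemma norm_triangle (n : nat) (x y : Vec n) : norm (fun i => x i + y i) <= norm x + norm y.
Proof.
  pose proof (norm_nonneg n x); pose proof (norm_nonneg n y).
  apply Rsqr_incr_0_var; [|lra]; unfold Rsqr.
  rewrite norm_sqr.
  replace (sumFin n (fun i => (x i + y i) ^ 2))
    with (norm x * norm x + 2 * dot x y + norm y * norm y).
  - pose proof (Cauchy_Schwarz n x y) as H1; apply Rabs_le_inv in H1; lra.
  - rewrite !norm_sqr; unfold dot; rewrite <- sumFin_scal, <- !sumFin_plus.
    apply sumFin_ext; intros i; ring.
Qed.

Lemma dist_triangle (n : nat) (x y z : Vec n) : dist x z <= dist x y + dist y z.
Proof.
  rewrite !dist_norm.
  replace (fun i => x i - z i) with (fun i => (x i - y i) + (y i - z i))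
    by (extensionality i; ring).
  apply (norm_triangle n (fun i => x i - y i) (fun i => y i - z i)).
Qed.

Lemma dist_sym (n : nat) (x y : Vec n) : dist x y = dist y x.
Proof. unfold dist; f_equal; apply sumFin_ext; intros i; ring. Qed.

Lemma dist_refl (n : nat) (x : Vec n) : dist x x = 0.
Proof.
  unfold dist; replace (sumFin n _) with (sumFin n (fun _ => 0)).
  - rewrite sumFin_const, Rmult_0_r; apply sqrt_0.
  - apply sumFin_ext; intros i; ring.
Qed.

Lemma dist_nonneg (n : nat) (x y : Vec n) : 0 <= dist x y.
Proof. apply sqrt_pos. Qed.

Lemma dot_sub (n : nat) (a x y : Vec n) : dot a (fun i => x i - y i) = dot a x - dot a y.
Proof.
  unfold dot.
  replace (sumFin n (fun i => a i * x i) - sumFin n (fun i => a i * y i))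
    with (sumFin n (fun i => a i * x i) + (-1) * sumFin n (fun i => a i * y i)) by ring.
  rewrite <- sumFin_scal, <- sumFin_plus; apply sumFin_ext; intros i; ring.
Qed.

Lemma dot_dist (n : nat) (a x y : Vec n) :
  Rabs (dot a x - dot a y) <= norm a * dist x y.
Proof. rewrite <- dot_sub, dist_norm; apply Cauchy_Schwarz. Qed.

Lemma norm_pos_ex (n : nat) (a : Vec n) : 0 < norm a -> exists i, a i <> 0.
Proof.
  intros H; apply NNPP; intros Hn.
  assert (norm a <= 0); [|lra].
  rewrite <- (Rmult_0_r (INR n)); apply norm_le_coord; [lra|].
  intros i; destruct (Req_dec (a i) 0) as [->|Hi]; [rewrite Rabs_R0; lra|].
  exfalso; apply Hn; exists i; exact Hi.
Qed.

(* For the inclusion of the slab in the neighbourhood, move along [a] to the orthogonal projection. *)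
Lemma nbhd_hyperplane (n : nat) (a : Vec n) (b eps : R) : 0 < norm a ->
  nbhd (hyperplane a b) eps = (fun y => Rabs (dot a y - b) <= eps * norm a).
Proof.
  intros Ha; extensionality y; apply propositional_extensionality; split.
  - intros [z [Hz Hd]]; rewrite <- Hz.
    apply Rle_trans with (1 := dot_dist n a y z); nra.
  - intros H; set (t := (dot a y - b) / (norm a * norm a)).
    exists (fun i => y i - t * a i); split.
    + unfold hyperplane; rewrite (dot_sub n a y (fun i => t * a i)).
      replace (dot a (fun i => t * a i)) with (t * (norm a * norm a)).
      * unfold t; field; lra.
      * rewrite norm_sqr; unfold dot; rewrite <- sumFin_scal.
        apply sumFin_ext; intros i; ring.
    + unfold dist.
      replace (sumFin n _) with (Rsqr (t * norm a)).
      * rewrite sqrt_Rsqr_abs, Rabs_mult, (Rabs_right (norm a)) by lra.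
        unfold t, Rdiv; rewrite Rabs_mult, Rabs_inv, (Rabs_right (norm a * norm a)) by nra.
        apply Rmult_le_reg_r with (norm a); [lra|].
        replace (Rabs (dot a y - b) * / (norm a * norm a) * norm a * norm a)
          with (Rabs (dot a y - b)) by (field; lra).
        exact H.
      * unfold Rsqr.
        replace (t * norm a * (t * norm a)) with (t ^ 2 * (norm a * norm a)) by ring.
        rewrite norm_sqr, <- sumFin_scal; apply sumFin_ext; intros i; ring.
Qed.

(** * Borel sets and measures *)

Lemma set_ext {T : Type} (A B : T -> Prop) : (forall x, A x <-> B x) -> A = B.
Proof.
  intros H; extensionality x; apply propositional_extensionality, H.
Qed.

Lemma borel_or {n : nat} (A B : Vec n -> Prop) :
  is_borel A -> is_borel B -> is_borel (fun x => A x \/ B x).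
Proof.
  intros HA HB.
  replace (fun x => A x \/ B x)
    with (fun x => exists k, (match k with O => A | _ => B end) x).
  - apply borel_union; intros [|k]; assumption.
  - apply set_ext; intros x; split.
    + intros [[|k] H]; tauto.
    + intros [H|H]; [exists O | exists 1%nat]; exact H.
Qed.

Lemma borel_and {n : nat} (A B : Vec n -> Prop) :
  is_borel A -> is_borel B -> is_borel (fun x => A x /\ B x).
Proof.
  intros HA HB.
  replace (fun x => A x /\ B x) with (fun x => ~ (~ A x \/ ~ B x)).
  - apply borel_compl, borel_or; apply borel_compl; assumption.
  - apply set_ext; intros x; split; [|tauto].
    intros H; split; apply NNPP; tauto.
Qed.

Lemma borel_diff {n : nat} (A B : Vec n -> Prop) :
  is_borel A -> is_borel B -> is_borel (fun x => A x /\ ~ B x).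
Proof. intros HA HB; apply borel_and; [|apply borel_compl]; assumption. Qed.

Lemma borel_empty {n : nat} : is_borel (fun _ : Vec n => False).
Proof. apply borel_open; intros x []. Qed.

Lemma borel_closed {n : nat} (A : Vec n -> Prop) : is_closed A -> is_borel A.
Proof.
  intros HA; replace A with (fun x => ~ ~ A x).
  - apply borel_compl, borel_open, HA.
  - apply set_ext; intros x; split; [apply NNPP | tauto].
Qed.

Lemma borel_cball {n : nat} (x : Vec n) (r : R) : is_borel (cball x r).
Proof.
  apply borel_closed; intros y Hy; unfold cball in *.
  exists (dist x y - r); split; [lra|].
  intros z Hz Hz'; pose proof (dist_triangle n x z y).
  rewrite (dist_sym n z y) in *; lra.
Qed.

Lemma borel_slab {n : nat} (a : Vec n) (b c : R) : 0 < norm a ->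
  is_borel (fun y => Rabs (dot a y - b) <= c).
Proof.
  intros Ha; apply borel_closed; intros y Hy.
  exists ((Rabs (dot a y - b) - c) / norm a); split.
  - apply Rdiv_lt_0_compat; lra.
  - intros z Hz Hz'.
    apply (Rmult_lt_compat_l (norm a)) in Hz; [|exact Ha].
    replace (norm a * ((Rabs (dot a y - b) - c) / norm a))
      with (Rabs (dot a y - b) - c) in Hz by (field; lra).
    pose proof (dot_dist n a y z).
    pose proof (Rabs_triang (dot a y - dot a z) (dot a z - b)).
    replace (dot a y - dot a z + (dot a z - b)) with (dot a y - b) in * by ring.
    lra.
Qed.

(** The value at [ERinf] is a default; the averaging argument applies [ERval] to sets of finite
    measure. *)
Definition ERval (a : ER) : R := match a with ERfin r => r | ERinf => 0 end.

Lemma ERle_antisym (a b : ER) : ERle a b -> ERle b a -> a = b.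
Proof.
  destruct a, b; simpl; intros; try tauto; f_equal; lra.
Qed.

Lemma mu_plus {n : nat} (mu : (Vec n -> Prop) -> ER) (A B : Vec n -> Prop) :
  is_borel_measure mu -> is_borel A -> is_borel B -> (forall x, A x -> B x -> False) ->
  mu (fun x => A x \/ B x) = ERplus (mu A) (mu B).
Proof.
  intros [H0 [Hpos Hadd]] HA HB Hd.
  (* Countable additivity for [A], [B] and then empty sets: the partial sums are constant from the
     second on. *)
  set (F := fun k : nat => match k with O => A | S O => B | _ => fun _ => False end).
  assert (HF : forall k, is_borel (F k)).
  { intros [|[|k]]; simpl; auto using @borel_empty. }
  destruct (Hadd F HF) as [Hub Hleast].
  { intros [|[|i]] [|[|j]] x; simpl; intros; try tauto; try lia; eauto. }
  replace (fun x => A x \/ B x) with (fun x => exists k, F k x).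
  2: { apply set_ext; intros x; split.
       - intros [[|[|k]] H]; simpl in H; tauto.
       - intros [H|H]; [exists O | exists 1%nat]; exact H. }
  assert (Hs : forall N, ERpsum (fun k => mu (F k)) (S (S N)) = ERplus (mu A) (mu B)).
  { induction N as [|N IH].
    - simpl; destruct (mu A), (mu B); simpl; try reflexivity; f_equal; ring.
    - change (ERplus (ERpsum (fun k => mu (F k)) (S (S N))) (mu (F (S (S N))))
              = ERplus (mu A) (mu B)).
      rewrite IH; simpl; rewrite H0.
      destruct (mu A), (mu B); simpl; try reflexivity; f_equal; ring. }
  apply ERle_antisym.
  - apply Hleast; intros y [[|[|N]] ->].
    + pose proof (Hpos A HA); pose proof (Hpos B HB); simpl.
      destruct (mu A), (mu B); simpl in *; auto; lra.
    + pose proof (Hpos A HA); pose proof (Hpos B HB); simpl.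
      destruct (mu A), (mu B); simpl in *; auto; lra.
    + rewrite Hs; destruct (ERplus (mu A) (mu B)); simpl; auto; lra.
  - apply Hub; exists 2%nat; rewrite Hs; reflexivity.
Qed.

Lemma mu_split {n : nat} (mu : (Vec n -> Prop) -> ER) (B E : Vec n -> Prop) :
  is_borel_measure mu -> is_borel B -> is_borel E ->
  mu B = ERplus (mu (fun x => B x /\ E x)) (mu (fun x => B x /\ ~ E x)).
Proof.
  intros Hm HB HE; rewrite <- mu_plus; auto using @borel_and, @borel_diff.
  - f_equal; apply set_ext; intros x; tauto.
  - tauto.
Qed.

Lemma mu_mono {n : nat} (mu : (Vec n -> Prop) -> ER) (A B : Vec n -> Prop) :
  is_borel_measure mu -> is_borel A -> is_borel B -> (forall x, A x -> B x) ->
  ERle (mu A) (mu B).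
Proof.
  intros Hm HA HB Hs; rewrite (mu_split mu B A Hm HB HA).
  replace (fun x => B x /\ A x) with A by (apply set_ext; firstorder).
  pose proof (proj1 (proj2 Hm) _ (borel_diff B A HB HA)) as Hd.
  destruct (mu A), (mu (fun x => B x /\ ~ A x)); simpl in *; auto; lra.
Qed.

Lemma borel_exists_lt {n : nat} (F : nat -> Vec n -> Prop) (k : nat) :
  (forall k, is_borel (F k)) -> is_borel (fun x => exists i, (i < k)%nat /\ F i x).
Proof.
  intros HF; apply borel_union; intros i.
  destruct (lt_dec i k) as [Hi|Hi].
  - replace (fun x => (i < k)%nat /\ F i x) with (F i) by (apply set_ext; tauto).
    apply HF.
  - replace (fun x => (i < k)%nat /\ F i x) with (fun _ : Vec n => False)
      by (apply set_ext; tauto).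
    apply borel_empty.
Qed.

Lemma ex_first (P : nat -> Prop) :
  (exists k, P k) -> exists k, P k /\ forall i, (i < k)%nat -> ~ P i.
Proof.
  intros [k Hk]; revert Hk; induction k as [k IH] using (well_founded_induction lt_wf).
  intros Hk; destruct (classic (exists i, (i < k)%nat /\ P i)) as [[i [Hi HPi]]|Hn].
  - exact (IH i Hi HPi).
  - exists k; split; [exact Hk|]; intros i Hi HPi; apply Hn; exists i; tauto.
Qed.

(** Keeping in [G k] only the points of [B] whose first index is [k] makes the cover disjoint. Each
    [G k] is still null, so all partial sums vanish. *)
Lemma mu_null_cover {n : nat} (mu : (Vec n -> Prop) -> ER) (B : Vec n -> Prop)
  (F : nat -> Vec n -> Prop) :
  is_borel_measure mu -> is_borel B -> (forall k, is_borel (F k)) ->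
  (forall k, mu (F k) = ERfin 0) -> (forall x, B x -> exists k, F k x) ->
  mu B = ERfin 0.
Proof.
  intros Hm HB HF H0 Hc.
  set (G := fun k x => (B x /\ F k x) /\ ~ exists i, (i < k)%nat /\ F i x).
  assert (HG : forall k, is_borel (G k)).
  { intros k; apply borel_diff; [apply borel_and; auto | apply borel_exists_lt; auto]. }
  assert (HG0 : forall k, mu (G k) = ERfin 0).
  { intros k; apply ERle_antisym; [|apply Hm; auto].
    rewrite <- (H0 k); apply mu_mono; auto; unfold G; tauto. }
  destruct Hm as [Hm0 [Hpos Hadd]].
  destruct (Hadd G HG) as [_ Hleast].
  { intros i j x Hij [[_ Hi] Hi'] [[_ Hj] Hj'].
    destruct (lt_eq_lt_dec i j) as [[H|H]|H]; [apply Hj' | exact (Hij H) | apply Hi'];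
      eexists; eauto. }
  replace B with (fun x => exists k, G k x).
  2: { apply set_ext; intros x; split; [intros [k Hk]; apply Hk|].
       intros Hx; destruct (ex_first _ (Hc x Hx)) as [k [Hk Hk']].
       exists k; split; [tauto|]; intros [i [Hi Hi']]; exact (Hk' i Hi Hi'). }
  assert (HU : is_borel (fun x => exists k, G k x)) by (apply borel_union; exact HG).
  apply ERle_antisym; [|apply Hpos; exact HU].
  apply Hleast; intros y [N ->].
  replace (ERpsum (fun k => mu (G k)) N) with (ERfin 0); [simpl; lra|].
  induction N as [|N IH]; [reflexivity|]; simpl.
  rewrite <- IH, HG0; simpl; f_equal; ring.
Qed.

Lemma dense_sequence_R :
  exists q : nat -> R, forall y eps, 0 < eps -> exists k, Rabs (y - q k) < eps.
Proof.
  (* All rationals [(a - b) / (d + 1)], coded by nested Cantor pairs; the numerator is a difference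
     so that it can be negative. *)
  exists (fun k => let (a, c) := Cantor.of_nat k in let (b, d) := Cantor.of_nat c in
             (INR a - INR b) / (INR d + 1)).
  intros y eps Heps.
  destruct (archimed_cor1 eps Heps) as [d [Hd Hd0]].
  set (z := Int_part (y * INR d)).
  exists (Cantor.to_nat (Z.to_nat z, Cantor.to_nat (Z.to_nat (- z), pred d))).
  rewrite !Cantor.cancel_of_to.
  replace (INR (pred d) + 1) with (INR d)
    by (rewrite <- S_INR; f_equal; lia).
  replace (INR (Z.to_nat z) - INR (Z.to_nat (- z))) with (IZR z).
  2: { rewrite !INR_IZR_INZ, <- minus_IZR; f_equal; lia. }
  assert (0 < INR d) by (apply lt_0_INR; exact Hd0).
  destruct (base_Int_part (y * INR d)) as [H1 H2]; fold z in H1, H2.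
  assert (E : (y - IZR z / INR d) * INR d = y * INR d - IZR z) by (field; lra).
  apply Rle_lt_trans with (/ INR d); [|exact Hd].
  apply Rabs_le.
  assert (E2 : / INR d * INR d = 1) by (field; lra).
  split; apply Rmult_le_reg_r with (INR d); lra.
Qed.

Lemma dense_sequence (n : nat) :
  exists e : nat -> Vec n, forall y eps, 0 < eps -> exists k, dist (e k) y <= eps.
Proof.
  assert (H : exists e : nat -> Vec n, forall y eps, 0 < eps ->
                exists k, forall i, Rabs (e k i - y i) <= eps).
  { induction n as [|n [e He]].
    - exists (fun _ _ => 0); intros y eps _; exists O; intros i; inversion i.
    - destruct dense_sequence_R as [q Hq].
      exists (fun k => let (a, b) := Cantor.of_nat k in
                 fun i => Fin.caseS' i (fun _ => R) (q a) (e b)).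
      intros y eps Heps.
      destruct (Hq (y Fin.F1) eps Heps) as [a Ha].
      destruct (He (fun i => y (Fin.FS i)) eps Heps) as [b Hb].
      exists (Cantor.to_nat (a, b)); rewrite Cantor.cancel_of_to.
      intros i; apply (Fin.caseS' i); simpl; [rewrite Rabs_minus_sym; lra | exact Hb]. }
  destruct H as [e He]; exists e; intros y eps Heps.
  assert (HN : 0 <= INR n) by apply pos_INR.
  destruct (He y (eps / (INR n + 1))) as [k Hk]; [apply Rdiv_lt_0_compat; lra|].
  exists k; rewrite dist_norm.
  assert (0 < eps / (INR n + 1)) by (apply Rdiv_lt_0_compat; lra).
  apply Rle_trans with (INR n * (eps / (INR n + 1))).
  - apply norm_le_coord; [lra | exact Hk].
  - apply Rle_trans with ((INR n + 1) * (eps / (INR n + 1))); [nra|].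
    apply Req_le; field; lra.
Qed.

(** A Lindelöf argument: a point off the support is the centre of a null ball, which contains a
    smaller ball around the point with centre in a dense sequence and radius [1 / (j + 1)].
    Countably many such null balls cover [B]. *)
Lemma mu_null_off_supp {n : nat} (mu : (Vec n -> Prop) -> ER) (B : Vec n -> Prop) :
  is_borel_measure mu -> is_borel B -> (forall x, B x -> ~ supp mu x) ->
  mu B = ERfin 0.
Proof.
  intros Hm HB Hs; destruct (dense_sequence n) as [e He].
  set (b := fun k => let (i, j) := Cantor.of_nat k in cball (e i) (/ (INR j + 1))).
  assert (Hb : forall k, is_borel (b k)).
  { intros k; unfold b; destruct (Cantor.of_nat k); apply borel_cball. }
  set (F := fun k => match excluded_middle_informative (mu (b k) = ERfin 0) with
                     | left _ => b k | right _ => fun _ => False end).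
  apply (mu_null_cover mu B F Hm HB).
  - intros k; unfold F; destruct excluded_middle_informative; auto using @borel_empty.
  - intros k; unfold F; destruct excluded_middle_informative; auto; apply Hm.
  - intros x Hx.
    destruct (not_all_ex_not _ _ (Hs x Hx)) as [r Hr].
    apply imply_to_and in Hr; destruct Hr as [Hr Hmu].
    assert (Hr2 : 0 < r / 2) by lra.
    destruct (archimed_cor1 (r / 2) Hr2) as [j [Hj Hj0]].
    assert (HJ : 0 < / INR j) by (apply Rinv_0_lt_compat, lt_0_INR; exact Hj0).
    destruct (He x (/ INR j) HJ) as [i Hi].
    exists (Cantor.to_nat (i, pred j)).
    assert (Eb : b (Cantor.to_nat (i, pred j)) = cball (e i) (/ INR j)).
    { unfold b; rewrite Cantor.cancel_of_to; do 2 f_equal.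
      rewrite <- S_INR; f_equal; lia. }
    unfold F; destruct excluded_middle_informative as [H0|H0].
    + rewrite Eb; exact Hi.
    + apply H0; rewrite Eb.
      assert (H1 : ERle (mu (cball (e i) (/ INR j))) (mu (cball x r))).
      { apply mu_mono; auto using @borel_cball; unfold cball; intros y Hy.
        pose proof (dist_triangle n x (e i) y); rewrite (dist_sym n x (e i)) in *; lra. }
      pose proof (proj1 (proj2 Hm) _ (borel_cball (e i) (/ INR j))) as H2.
      apply ERle_antisym; [|exact H2].
      destruct (mu (cball (e i) (/ INR j))), (mu (cball x r)); simpl in *; lra.
Qed.

(** * Averaging over a measure *)

Fixpoint nsum (f : nat -> R) (N : nat) : R :=
  match N with O => 0 | S N' => nsum f N' + f N' end.

Lemma nsum_le (f g : nat -> R) (N : nat) :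
  (forall j, (j < N)%nat -> f j <= g j) -> nsum f N <= nsum g N.
Proof.
  induction N as [|N IH]; simpl; intros H; [lra|].
  apply Rplus_le_compat; [apply IH; intros; apply H; lia | apply H; lia].
Qed.

Lemma nsum_plus (f g : nat -> R) (N : nat) :
  nsum (fun j => f j + g j) N = nsum f N + nsum g N.
Proof. induction N as [|N IH]; simpl; [lra | rewrite IH; lra]. Qed.

Lemma nsum_scal (c : R) (f : nat -> R) (N : nat) :
  nsum (fun j => c * f j) N = c * nsum f N.
Proof. induction N as [|N IH]; simpl; [lra | rewrite IH; lra]. Qed.

Lemma nsum_nonneg (f : nat -> R) (N : nat) : (forall j, 0 <= f j) -> 0 <= nsum f N.
Proof.
  intros H; induction N as [|N IH]; simpl; [lra|]; specialize (H N); lra.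
Qed.

Lemma nsum_ge_term (f : nat -> R) (N j : nat) :
  (forall j, 0 <= f j) -> (j < N)%nat -> f j <= nsum f N.
Proof.
  intros H Hj; induction N as [|N IH]; [lia|]; simpl.
  pose proof (H N); destruct (Nat.eq_dec j N) as [->|Hne].
  - pose proof (nsum_nonneg f N H); lra.
  - assert (f j <= nsum f N) by (apply IH; lia); lra.
Qed.

Definition ind (P : Prop) : R := if excluded_middle_informative P then 1 else 0.

Lemma ind_true (P : Prop) : P -> ind P = 1.
Proof. intros H; unfold ind; destruct excluded_middle_informative; tauto. Qed.

Lemma ind_false (P : Prop) : ~ P -> ind P = 0.
Proof. intros H; unfold ind; destruct excluded_middle_informative; tauto. Qed.

Lemma ind_bounds (P : Prop) : 0 <= ind P <= 1.
Proof. unfold ind; destruct excluded_middle_informative; lra. Qed.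

Lemma ERval_split {n : nat} (mu : (Vec n -> Prop) -> ER) (B E : Vec n -> Prop) :
  is_borel_measure mu -> is_borel B -> is_borel E -> mu B <> ERinf ->
  mu (fun x => B x /\ E x) <> ERinf /\ mu (fun x => B x /\ ~ E x) <> ERinf /\
  ERval (mu B) = ERval (mu (fun x => B x /\ E x)) + ERval (mu (fun x => B x /\ ~ E x)).
Proof.
  intros Hm HB HE; rewrite (mu_split mu B E Hm HB HE).
  destruct (mu (fun x => B x /\ E x)), (mu (fun x => B x /\ ~ E x)); simpl;
    intros H; try tauto; repeat split; congruence.
Qed.

(* A Chebyshev inequality for simple functions; by induction on the number of pieces, splitting
   [B] along the last one. *)
Lemma simple_function_average {n : nat} (mu : (Vec n -> Prop) -> ER) (w : nat -> R)
  (E : nat -> Vec n -> Prop) :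
  is_borel_measure mu -> (forall j, is_borel (E j)) ->
  forall (J : nat) (t : R) (B : Vec n -> Prop), is_borel B -> mu B <> ERinf ->
  (forall x, B x -> supp mu x -> t <= nsum (fun j => w j * ind (E j x)) J) ->
  t * ERval (mu B) <= nsum (fun j => w j * ERval (mu (fun x => B x /\ E j x))) J.
Proof.
  intros Hm HE; induction J as [|J IH]; intros t B HB Hfin Ht; simpl.
  - pose proof (proj1 (proj2 Hm) B HB) as Hpos.
    (* For [t > 0] the empty sum falls short of [t], so [B] has no support point and is null. *)
    destruct (Rle_dec t 0) as [Ht0|Ht0].
    + destruct (mu B); simpl in *; nra.
    + rewrite (mu_null_off_supp mu B Hm HB); [simpl; lra|].
      intros x Hx Hs; specialize (Ht x Hx Hs); simpl in Ht; lra.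
  - destruct (ERval_split mu B (E J) Hm HB (HE J) Hfin) as [F1 [F2 Hval]].
    (* On [E J] the last piece contributes [w J], so the others reach at least [t - w J]; off [E J]
       they reach [t] by themselves. *)
    pose proof (IH (t - w J) _ (borel_and _ _ HB (HE J)) F1) as IH1.
    pose proof (IH t _ (borel_diff _ _ HB (HE J)) F2) as IH2.
    assert (Hsum : nsum (fun j => w j * ERval (mu (fun x => B x /\ E j x))) J =
      nsum (fun j => w j * ERval (mu (fun x => (B x /\ E J x) /\ E j x))) J +
      nsum (fun j => w j * ERval (mu (fun x => (B x /\ ~ E J x) /\ E j x))) J).
    { rewrite <- nsum_plus; f_equal; extensionality j.
      destruct (ERval_split mu B (E j) Hm HB (HE j) Hfin) as [Fj _].
      destruct (ERval_split mu _ (E J) Hm (borel_and _ _ HB (HE j)) (HE J) Fj)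
        as [_ [_ ->]].
      rewrite Rmult_plus_distr_l.
      do 2 f_equal; do 2 f_equal; apply set_ext; intros x; tauto. }
    rewrite Hsum, Hval.
    lapply IH1; [clear IH1; intros IH1|].
    + lapply IH2; [clear IH2; intros IH2; lra|].
      intros x [Hx HEx] Hs; specialize (Ht x Hx Hs); simpl in Ht.
      rewrite (ind_false _ HEx) in Ht; lra.
    + intros x [Hx HEx] Hs; specialize (Ht x Hx Hs); simpl in Ht.
      rewrite (ind_true _ HEx) in Ht; lra.
Qed.

(** Serves balls of infinite measure: each step takes away a part of finite measure, so what remains
    stays infinite. *)
Lemma mu_inf_remove {n : nat} (mu : (Vec n -> Prop) -> ER) (E : nat -> Vec n -> Prop)
  (B : Vec n -> Prop) (J : nat) :
  is_borel_measure mu -> (forall j, is_borel (E j)) -> is_borel B -> mu B = ERinf ->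
  (forall j, mu (fun x => B x /\ E j x) <> ERinf) ->
  mu (fun x => B x /\ ~ exists j, (j < J)%nat /\ E j x) = ERinf.
Proof.
  intros Hm HE HB Hinf Hfin; induction J as [|J IH].
  - rewrite <- Hinf; f_equal; apply set_ext; intros x; split; [tauto|].
    intros Hx; split; [exact Hx|]; intros [j [Hj _]]; lia.
  - assert (HBJ := borel_diff B _ HB (borel_exists_lt E J HE)).
    rewrite (mu_split mu _ (E J) Hm HBJ (HE J)) in IH.
    assert (Hle : ERle (mu (fun x => (B x /\ ~ exists j, (j < J)%nat /\ E j x) /\ E J x))
                       (mu (fun x => B x /\ E J x))).
    { apply mu_mono; auto using @borel_and; tauto. }
    replace (fun x => B x /\ ~ exists j, (j < S J)%nat /\ E j x)
      with (fun x => (B x /\ ~ exists j, (j < J)%nat /\ E j x) /\ ~ E J x).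
    + specialize (Hfin J).
      destruct (mu (fun x => B x /\ E J x)); [|tauto].
      destruct (mu (fun x => (B x /\ ~ exists j, (j < J)%nat /\ E j x) /\ E J x));
        [|contradiction].
      destruct (mu (fun x => (B x /\ ~ exists j, (j < J)%nat /\ E j x) /\ ~ E J x));
        [discriminate | reflexivity].
    + apply set_ext; intros x; split.
      * intros [[Hx H1] H2]; split; [exact Hx|]; intros [j [Hj Hj']].
        destruct (Nat.eq_dec j J) as [->|]; [tauto|].
        apply H1; exists j; split; [lia | exact Hj'].
      * intros [Hx H]; repeat split; [exact Hx | |].
        -- intros [j [Hj Hj']]; apply H; exists j; split; [lia | exact Hj'].
        -- intros H'; apply H; exists J; split; [lia | exact H'].
Qed.

(** If every support point of the ball carried more than a quarter of the total weight, the average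
    over the ball would be at least that quarter, whereas the bound [1 / 8] on each [E j] keeps it
    to at most an eighth. *)
Lemma weighted_avoidance {n : nat} (mu : (Vec n -> Prop) -> ER) (x : Vec n) (r : R)
  (E : nat -> Vec n -> Prop) (w : nat -> R) (J : nat) :
  is_borel_measure mu -> supp mu x -> 0 < r -> (forall j, is_borel (E j)) ->
  (forall j, 0 <= w j) ->
  (forall j, ERlt (mu (fun y => cball x r y /\ E j y)) (ERscale (1 / 8) (mu (cball x r)))) ->
  exists y, supp mu y /\ dist x y <= r /\
    nsum (fun j => w j * ind (E j y)) J <= 1 / 4 * nsum w J.
Proof.
  intros Hm Hx Hr HE Hw Hdec.
  assert (HB := borel_cball x r).
  assert (HW : 0 <= nsum w J) by (apply nsum_nonneg; exact Hw).
  destruct (classic (mu (cball x r) = ERinf)) as [Hinf|Hfin].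
  (* Deleting all the [E j] leaves infinite measure, hence a support point, and this point carries
     no weight. *)
  - assert (Hrem := mu_inf_remove mu E _ J Hm HE HB Hinf).
    lapply Hrem; clear Hrem; [intros Hrem|].
    + apply NNPP; intros Hn.
      rewrite mu_null_off_supp in Hrem; [discriminate | exact Hm | |].
      * apply borel_diff; [exact HB | apply borel_exists_lt; exact HE].
      * intros y [Hy Hy'] Hs; apply Hn; exists y; repeat split; [exact Hs | exact Hy |].
        apply Rle_trans with (nsum (fun j => 0 * w j) J); [|rewrite nsum_scal; lra].
        apply nsum_le; intros j Hj; rewrite ind_false; [lra|].
        intros HEj; apply Hy'; exists j; tauto.
    + intros j Hj; specialize (Hdec j); rewrite Hj in Hdec; exact Hdec.
  - apply NNPP; intros Hn.
    pose proof (simple_function_average mu w E Hm HE J (1 / 4 * nsum w J) _ HB Hfin) as Hav.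
    lapply Hav; clear Hav; [intros Hav|].
    + pose proof (Hx r Hr) as Hpos.
      assert (Hup : nsum (fun j => w j * ERval (mu (fun y => cball x r y /\ E j y))) J <=
                    nsum (fun j => 1 / 8 * ERval (mu (cball x r)) * w j) J).
      { apply nsum_le; intros j _; specialize (Hdec j); specialize (Hw j).
        destruct (mu (cball x r)); [|tauto].
        destruct (mu (fun y => cball x r y /\ E j y)); simpl in *; [nra | tauto]. }
      rewrite nsum_scal in Hup.
      assert (Hb : 0 < ERval (mu (cball x r))) by (destruct (mu (cball x r)); simpl in *; tauto).
      (* Only zero total weight is left, and then the centre [x] itself will do. *)
      assert (HW0 : nsum w J <= 0) by nra.
      apply Hn; exists x; repeat split; [exact Hx | rewrite dist_refl; lra |].
      apply Rle_trans with (nsum w J); [|lra].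
      apply nsum_le; intros j _; pose proof (ind_bounds (E j x)); specialize (Hw j); nra.
    + intros y Hy Hs; apply Rnot_lt_le; intros Hlt; apply Hn; exists y.
      repeat split; [exact Hs | exact Hy | lra].
Qed.

(** * Playing against a lacunary sequence of hyperplane families *)

Lemma nsum_tail (f : nat -> R) (J J' : nat) :
  (J <= J')%nat -> (forall j, (J <= j)%nat -> f j = 0) -> nsum f J' = nsum f J.
Proof.
  intros HJ Hf; induction HJ as [|J' HJ IH]; [reflexivity|].
  simpl; rewrite (Hf J' HJ), IH; ring.
Qed.

Lemma nsum_window (f : nat -> R) (W : R) (i0 L J : nat) :
  0 <= W -> (forall j, f j <= W) ->
  (forall j, ~ (i0 <= j < i0 + L)%nat -> f j <= 0) -> nsum f J <= INR L * W.
Proof.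
  intros HW Hf H0.
  (* With truncated subtraction, [Nat.min (J - i0) L] counts the window indices below [J]. *)
  assert (Hs : nsum f J <= INR (Nat.min (J - i0) L) * W).
  { induction J as [|J IH]; [simpl; lra|].
    cbn [nsum].
    destruct (classic (i0 <= J < i0 + L)%nat) as [Hin|Hout].
    - replace (Nat.min (S J - i0) L) with (S (Nat.min (J - i0) L)) by lia.
      rewrite S_INR; specialize (Hf J); lra.
    - specialize (H0 J Hout).
      assert (INR (Nat.min (J - i0) L) <= INR (Nat.min (S J - i0) L)) by (apply le_INR; lia).
      nra. }
  apply Rle_trans with (1 := Hs), Rmult_le_compat_r; [exact HW | apply le_INR; lia].
Qed.

Lemma INR_lt_pow2 (j : nat) : INR j < 2 ^ j.
Proof.
  induction j as [|j IH]; [simpl; lra|].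
  rewrite S_INR; simpl.
  assert (1 <= 2 ^ j) by (apply pow_R1_Rle; lra); lra.
Qed.

Lemma pow2_unbounded (a : R) : exists j, a < 2 ^ j.
Proof.
  destruct (INR_archimed 1 a) as [j Hj]; [lra|].
  exists j; pose proof (INR_lt_pow2 j); lra.
Qed.

Lemma pow2_threshold (a : R) : exists i0, forall j, a < 2 ^ j <-> (i0 <= j)%nat.
Proof.
  destruct (ex_first _ (pow2_unbounded a)) as [i0 [Hi0 Hmin]].
  exists i0; intros j; split.
  - intros Hj; destruct (le_lt_dec i0 j) as [H|H]; [exact H|].
    exfalso; exact (Hmin j H Hj).
  - intros Hj; apply Rlt_le_trans with (1 := Hi0), Rle_pow; [lra | exact Hj].
Qed.

Lemma Rpower_neg_anti (a b s : R) : 0 < a -> a <= b -> 0 < s ->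
  Rpower b (- s) <= Rpower a (- s).
Proof.
  intros Ha Hab Hs; rewrite !Rpower_Ropp.
  apply Rinv_le_contravar; [apply exp_pos | apply Rle_Rpower_l; lra].
Qed.

(** For nonzero [a]: [x] is within [eps] of one of the parallel hyperplanes [dot a y = p], by
    [nbhd_hyperplane]. *)
Definition near_integer {n : nat} (a : Vec n) (eps : R) (x : Vec n) : Prop :=
  exists p : Z, Rabs (dot a x - IZR p) <= eps * norm a.

(** When [norm (z j) <= kappa * 2 ^ j], the hyperplanes of an active family are at least [4 * rho]
    apart, so at most one matters to a ball of radius [rho]. *)
Definition active (kappa : R) (j : nat) (rho : R) : Prop := kappa * 2 ^ j * rho <= 1 / 4.

Definition weight (kappa s : R) (j : nat) (rho : R) : R :=
  ind (active kappa j rho) * Rpower (2 ^ j * rho) (- s).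

Definition potential {n : nat} (z : nat -> Vec n) (kappa s : R) (J : nat) (x : Vec n)
  (rho : R) : R :=
  nsum (fun j => weight kappa s j rho * ind (near_integer (z j) (2 * rho) x)) J.

(** [J] truncates a sum over all families; inactive ones weigh nothing, so every admissible [J]
    gives the same inequality. The margin [2 * alpha * rho] covers whatever can be near Bob's next
    ball inside Alice's. *)
Definition good_move {n : nat} (z : nat -> Vec n) (kappa s alpha : R) (x : Vec n)
  (rho : R) (x' : Vec n) : Prop :=
  forall J, (forall j, (J <= j)%nat -> ~ active kappa j rho) ->
    nsum (fun j => weight kappa s j rho * ind (near_integer (z j) (2 * rho) x)
                   * ind (near_integer (z j) (2 * alpha * rho) x')) J
    <= 1 / 4 * potential z kappa s J x rho.

Lemma weight_nonneg (kappa s : R) (j : nat) (rho : R) : 0 <= weight kappa s j rho.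
Proof.
  unfold weight; pose proof (ind_bounds (active kappa j rho)).
  pose proof (exp_pos (- s * ln (2 ^ j * rho))); unfold Rpower; nra.
Qed.

Lemma weight_inactive (kappa s : R) (j : nat) (rho : R) :
  ~ active kappa j rho -> weight kappa s j rho = 0.
Proof. intros H; unfold weight; rewrite ind_false by exact H; ring. Qed.

Lemma weight_active (kappa s : R) (j : nat) (rho : R) :
  active kappa j rho -> weight kappa s j rho = Rpower (2 ^ j * rho) (- s).
Proof. intros H; unfold weight; rewrite ind_true by exact H; ring. Qed.

Lemma inactive_threshold (kappa rho : R) : 0 < kappa -> 0 < rho ->
  exists J, forall j, (J <= j)%nat -> ~ active kappa j rho.
Proof.
  intros Hk Hr; destruct (pow2_threshold (/ (4 * (kappa * rho)))) as [J HJ].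
  exists J; intros j Hj; apply HJ in Hj; unfold active; intros Ha.
  assert (0 < kappa * rho) by nra.
  apply (Rmult_lt_compat_l (4 * (kappa * rho))) in Hj; [|lra].
  rewrite Rinv_r in Hj by lra; nra.
Qed.

(** Going from [x] through [x'] to the hyperplane changes [dot a] by at most
    [norm a * rho <= 1 / 4], so [p] is the integer nearest to [dot a x]. The formula with [up] does
    not mention [x'], so the slab to avoid is known before [x'] is chosen. *)
Lemma near_integer_unique {n : nat} (a x x' : Vec n) (rho alpha : R) (p : Z) :
  0 < rho -> alpha <= 1 / 4 -> norm a * rho <= 1 / 4 -> dist x x' <= rho / 2 ->
  Rabs (dot a x' - IZR p) <= 2 * alpha * rho * norm a -> p = up (dot a x - 1 / 2).
Proof.
  intros Hr Ha Hn Hd Hp.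
  pose proof (norm_nonneg n a) as Hn0.
  pose proof (dot_dist n a x x') as H1.
  assert (H2 : norm a * dist x x' <= norm a * (rho / 2)) by (apply Rmult_le_compat_l; lra).
  assert (H3 : 2 * alpha * rho * norm a <= 1 / 2 * (norm a * rho))
    by (assert (0 <= norm a * rho) by nra; nra).
  apply Rabs_le_inv in Hp; apply Rabs_le_inv in H1.
  destruct (archimed (dot a x - 1 / 2)) as [H4 H5].
  set (q := up (dot a x - 1 / 2)) in *.
  apply Z.le_antisymm; apply Z.lt_succ_r; apply lt_IZR; rewrite succ_IZR; lra.
Qed.

Definition decaying_below {n : nat} (mu : (Vec n -> Prop) -> ER) (C gam rho0 : R) : Prop :=
  forall (a : Vec n) (b : R), (exists i, a i <> 0) -> forall x, supp mu x ->
    forall rho, 0 < rho -> rho < rho0 -> forall eps, 0 < eps ->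
      ERlt (mu (fun y => cball x rho y /\ nbhd (hyperplane a b) eps y))
           (ERscale (C * Rpower (eps / rho) gam) (mu (cball x rho))).

Lemma good_move_exists {n : nat} (mu : (Vec n -> Prop) -> ER) (C gam rho0 alpha : R)
  (z : nat -> Vec n) (kappa s : R) (x : Vec n) (rho : R) :
  is_borel_measure mu ->
  decaying_below mu C gam rho0 ->
  0 < alpha <= 1 / 4 -> C * Rpower (4 * alpha) gam <= 1 / 8 ->
  0 < kappa -> (forall j, 0 < norm (z j) <= kappa * 2 ^ j) ->
  supp mu x -> 0 < rho < rho0 ->
  exists x', supp mu x' /\ dist x x' <= rho / 2 /\ good_move z kappa s alpha x rho x'.
Proof.
  intros Hm Hdec Ha HC Hk Hz Hx Hrho.
  destruct (inactive_threshold kappa rho Hk (proj1 Hrho)) as [J0 HJ0].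
  set (w := fun j => weight kappa s j rho * ind (near_integer (z j) (2 * rho) x)).
  (* One slab per family, around the only hyperplane that an active family can bring near a point
     within [rho / 2] of [x]. *)
  set (E := fun j y => Rabs (dot (z j) y - IZR (up (dot (z j) x - 1 / 2)))
                       <= 2 * alpha * rho * norm (z j)).
  destruct (weighted_avoidance mu x (rho / 2) E w J0 Hm Hx) as [x' [Hx' [Hd Hsum]]].
  - lra.
  - intros j; apply borel_slab, Hz.
  - intros j; unfold w; pose proof (weight_nonneg kappa s j rho).
    pose proof (ind_bounds (near_integer (z j) (2 * rho) x)); nra.
  - intros j.
    pose proof (Hdec (z j) (IZR (up (dot (z j) x - 1 / 2))) (norm_pos_ex n _ (proj1 (Hz j)))
                  x Hx (rho / 2)) as H.
    specialize (H ltac:(lra) ltac:(lra) (2 * alpha * rho) ltac:(nra)).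
    rewrite nbhd_hyperplane in H by apply Hz.
    (* Half-width [2 * alpha * rho] in a ball of radius [rho / 2]: this is the [4 * alpha] of the
       hypothesis on [C]. *)
    replace (2 * alpha * rho / (rho / 2)) with (4 * alpha) in H by (field; lra).
    pose proof (proj1 (proj2 Hm) _ (borel_cball x (rho / 2))) as Hpos; unfold E.
    destruct (mu (cball x (rho / 2))) as [b|];
      destruct (mu (fun y => cball x (rho / 2) y /\ _)); simpl in *; auto; nra.
  - exists x'; repeat split; [exact Hx' | exact Hd |].
    intros J HJ; unfold potential.
    set (f := fun j => weight kappa s j rho * ind (near_integer (z j) (2 * rho) x)
                       * ind (near_integer (z j) (2 * alpha * rho) x')).
    change (nsum f J <= 1 / 4 * nsum w J).
    assert (Htail : forall g : nat -> R, (forall j, ~ active kappa j rho -> g j = 0) ->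
              nsum g J = nsum g J0).
    { intros g Hg; transitivity (nsum g (J0 + J)); [symmetry|];
        (apply nsum_tail; [lia|]; intros j Hj; apply Hg; auto). }
    rewrite !Htail.
    + apply Rle_trans with (2 := Hsum), nsum_le; intros j _.
      destruct (classic (active kappa j rho)) as [Hact|Hact].
      2: { unfold f, w; rewrite weight_inactive by exact Hact; lra. }
      assert (Hw : 0 <= w j).
      { unfold w; pose proof (weight_nonneg kappa s j rho).
        pose proof (ind_bounds (near_integer (z j) (2 * rho) x)); nra. }
      unfold f; fold (w j); apply Rmult_le_compat_l; [exact Hw|].
      destruct (classic (near_integer (z j) (2 * alpha * rho) x')) as [[p Hp]|Hno].
      * rewrite (ind_true (E j x')); [apply ind_bounds|].
        unfold E; rewrite <- (near_integer_unique (z j) x x' rho alpha p); try lra; try tauto.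
        unfold active in Hact; specialize (Hz j); nra.
      * rewrite ind_false by exact Hno; apply ind_bounds.
    + intros j Hj; unfold w; rewrite weight_inactive by exact Hj; ring.
    + intros j Hj; unfold f; rewrite weight_inactive by exact Hj; ring.
Qed.

(** A family counted at the new ball was either active before, and then it was near [x] and [x'],
    its weight doubles, and [good_move] bounds such weights by a quarter of the potential; or it has
    just become active, which happens to at most [L] families. *)
Lemma potential_step {n : nat} (z : nat -> Vec n) (kappa s alpha beta : R) (L J : nat)
  (x x' x'' : Vec n) (rho : R) :
  0 < alpha <= 1 / 4 -> 0 < beta < 1 -> 0 < kappa -> 0 < s -> 0 < rho ->
  Rpower (alpha * beta) (- s) = 2 -> / (alpha * beta) <= 2 ^ L ->
  dist x x' <= rho / 2 -> good_move z kappa s alpha x rho x' ->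
  alpha * beta * rho + dist x' x'' <= alpha * rho ->
  (forall j, (J <= j)%nat -> ~ active kappa j rho) ->
  potential z kappa s J x'' (alpha * beta * rho)
  <= 1 / 2 * potential z kappa s J x rho
     + INR L * Rpower (alpha * beta / (4 * kappa)) (- s).
Proof.
  intros Ha Hb Hk Hs Hr Hab HL Hd Hg Hd' HJ.
  assert (Hab0 : 0 < alpha * beta) by nra.
  set (r2 := alpha * beta * rho) in *.
  assert (Hr2 : 0 < r2) by (unfold r2; nra).
  assert (Hr2' : r2 <= alpha * rho) by (pose proof (dist_nonneg n x' x''); lra).
  (* A newly active family has [2 ^ j * rho > 1 / (4 * kappa)], hence
     [2 ^ j * r2 > alpha * beta / (4 * kappa)], and its weight is at most [W]. *)
  set (W := Rpower (alpha * beta / (4 * kappa)) (- s)).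
  assert (HW : 0 < W) by apply exp_pos.
  set (new := fun j => W * ind (~ active kappa j rho /\ active kappa j r2)).
  assert (Hnew : nsum new J <= INR L * W).
  { destruct (pow2_threshold (/ (4 * (kappa * rho)))) as [i0 Hi0].
    assert (Hkr : 0 < kappa * rho) by nra.
    assert (Hact : forall j, ~ active kappa j rho <-> (i0 <= j)%nat).
    { intros j; rewrite <- Hi0; unfold active; split; intros H.
      - apply Rmult_lt_reg_l with (4 * (kappa * rho)); [lra|].
        rewrite Rinv_r by lra; nra.
      - apply (Rmult_lt_compat_l (4 * (kappa * rho))) in H; [|lra].
        rewrite Rinv_r in H by lra; nra. }
    apply nsum_window with i0; [lra | |].
    - intros j; unfold new; pose proof (ind_bounds (~ active kappa j rho /\ active kappa j r2)).
      nra.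
    - intros j Hj; unfold new; rewrite ind_false; [lra|].
      intros [H1 H2]; apply Hj; split; [apply Hact, H1|].
      apply Nat.nle_gt; intros Hle.
      (* Past the window, family [j - L] is inactive at [rho]; but [2 ^ L * (alpha * beta) >= 1], so
         activity of [j] at [r2] would make it active. *)
      assert (H3 : ~ active kappa (j - L) rho) by (apply Hact; lia).
      apply H3; unfold active in *.
      assert (E : 2 ^ j = 2 ^ (j - L) * 2 ^ L) by (rewrite <- pow_add; f_equal; lia).
      rewrite E in H2; unfold r2 in H2.
      assert (H4 : 1 <= 2 ^ L * (alpha * beta)).
      { apply (Rmult_le_compat_r (alpha * beta)) in HL; [|lra].
        rewrite Rinv_l in HL; lra. }
      assert (H5 : 0 <= kappa * 2 ^ (j - L) * rho).
      { assert (0 < 2 ^ (j - L)) by (apply pow_lt; lra). nra. }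
      nra. }
  specialize (Hg J HJ).
  apply Rle_trans with
    (2 * nsum (fun j => weight kappa s j rho * ind (near_integer (z j) (2 * rho) x)
                   * ind (near_integer (z j) (2 * alpha * rho) x')) J + nsum new J);
    [|lra].
  rewrite <- nsum_scal, <- nsum_plus; unfold potential.
  apply nsum_le; intros j _.
  assert (H2j : 0 < 2 ^ j) by (apply pow_lt; lra).
  assert (Hnew0 : 0 <= new j).
  { unfold new; pose proof (ind_bounds (~ active kappa j rho /\ active kappa j r2)); nra. }
  pose proof (weight_nonneg kappa s j rho) as Hw0.
  pose proof (ind_bounds (near_integer (z j) (2 * rho) x)) as Hi1.
  pose proof (ind_bounds (near_integer (z j) (2 * alpha * rho) x')) as Hi2.
  assert (Hprod : 0 <= 2 * (weight kappa s j rho * ind (near_integer (z j) (2 * rho) x)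
                   * ind (near_integer (z j) (2 * alpha * rho) x'))).
  { apply Rmult_le_pos; [lra|]; apply Rmult_le_pos; [apply Rmult_le_pos|]; tauto. }
  destruct (classic (active kappa j r2)) as [Hact2|Hact2].
  2: { rewrite weight_inactive by exact Hact2; lra. }
  destruct (classic (near_integer (z j) (2 * r2) x'')) as [[p Hp]|Hno].
  2: { rewrite ind_false by exact Hno; lra. }
  rewrite (ind_true (near_integer (z j) (2 * r2) x'')) by (exists p; exact Hp).
  rewrite (weight_active _ _ _ _ Hact2), Rmult_1_r.
  destruct (classic (active kappa j rho)) as [Hact|Hact].
  - pose proof (norm_nonneg n (z j)) as Hn0.
    pose proof (dot_dist n (z j) x' x'') as D1; pose proof (dot_dist n (z j) x x') as D2.
    assert (M1 : norm (z j) * dist x' x'' <= norm (z j) * (alpha * rho - r2))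
      by (apply Rmult_le_compat_l; lra).
    assert (M2 : norm (z j) * dist x x' <= norm (z j) * (rho / 2))
      by (apply Rmult_le_compat_l; lra).
    assert (M3 : norm (z j) * r2 <= norm (z j) * (alpha * rho))
      by (apply Rmult_le_compat_l; lra).
    (* In units of [norm (z j)]: [(alpha * rho - r2) + 2 * r2 <= 2 * alpha * rho] here, and
       [rho / 2 + 2 * alpha * rho <= 2 * rho] for [N2]. *)
    assert (N1 : Rabs (dot (z j) x' - IZR p) <= 2 * alpha * rho * norm (z j)).
    { pose proof (Rabs_triang (dot (z j) x' - dot (z j) x'') (dot (z j) x'' - IZR p)) as T.
      replace (dot (z j) x' - dot (z j) x'' + (dot (z j) x'' - IZR p))
        with (dot (z j) x' - IZR p) in T by ring; lra. }
    assert (N2 : Rabs (dot (z j) x - IZR p) <= 2 * rho * norm (z j)).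
    { pose proof (Rabs_triang (dot (z j) x - dot (z j) x') (dot (z j) x' - IZR p)) as T.
      replace (dot (z j) x - dot (z j) x' + (dot (z j) x' - IZR p))
        with (dot (z j) x - IZR p) in T by ring.
      assert (norm (z j) * (alpha * rho) <= norm (z j) * (1 / 4 * rho))
        by (apply Rmult_le_compat_l; [lra|]; apply Rmult_le_compat_r; lra).
      assert (0 <= norm (z j) * rho) by (apply Rmult_le_pos; lra).
      lra. }
    rewrite (ind_true (near_integer (z j) (2 * rho) x)) by (exists p; exact N2).
    rewrite (ind_true (near_integer (z j) (2 * alpha * rho) x')) by (exists p; exact N1).
    rewrite (weight_active _ _ _ _ Hact).
    replace (2 ^ j * r2) with (alpha * beta * (2 ^ j * rho)) by (unfold r2; ring).
    rewrite <- Rpower_mult_distr by nra.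
    rewrite Hab; lra.
  - replace (new j) with W by (unfold new; rewrite ind_true by tauto; ring).
    apply Rle_trans with W; [|lra].
    apply Rpower_neg_anti; [apply Rdiv_lt_0_compat; lra | | exact Hs].
    unfold active in Hact; unfold r2.
    apply Rmult_le_reg_r with (4 * kappa); [lra|].
    replace (alpha * beta / (4 * kappa) * (4 * kappa)) with (alpha * beta) by (field; lra).
    nra.
Qed.

Lemma potential_bounded_at {n : nat} (z : nat -> Vec n) (kappa s : R) (x : Vec n) (rho : R) :
  0 < kappa -> 0 < s -> 0 < rho -> exists D, forall J, potential z kappa s J x rho <= D.
Proof.
  intros Hk Hs Hr; destruct (inactive_threshold kappa rho Hk Hr) as [J0 HJ0].
  exists (INR J0 * Rpower rho (- s)); intros J.
  apply nsum_window with O; [apply Rlt_le, exp_pos | |].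
  - intros j; pose proof (ind_bounds (near_integer (z j) (2 * rho) x)) as Hi.
    pose proof (weight_nonneg kappa s j rho) as Hw.
    apply Rle_trans with (weight kappa s j rho); [nra|].
    unfold weight; pose proof (ind_bounds (active kappa j rho)).
    pose proof (exp_pos (- s * ln (2 ^ j * rho))) as He; fold (Rpower (2 ^ j * rho) (- s)) in He.
    apply Rle_trans with (Rpower (2 ^ j * rho) (- s)); [nra|].
    apply Rpower_neg_anti; [exact Hr | | exact Hs].
    assert (1 <= 2 ^ j) by (apply pow_R1_Rle; lra); nra.
  - intros j Hj; rewrite weight_inactive; [lra|]; apply HJ0; lia.
Qed.

Lemma choice_fun {A B : Type} (P : A -> B -> Prop) :
  (forall a, exists b, P a b) -> exists f : A -> B, forall a, P a (f a).
Proof.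
  intros H; exists (fun a => proj1_sig (constructive_indefinite_description _ (H a))).
  intros a; apply proj2_sig.
Qed.

Lemma last_bob_prefix {n : nat} (b : nat -> Ball n) (k : nat) (d : Ball n) :
  last (bob_prefix b k) d = b k.
Proof.
  unfold bob_prefix; rewrite seq_S, map_app; simpl; apply last_last.
Qed.

(** [D] is at least twice the contribution [c] of new families, so [D / 2 + c <= D] and
    [potential_step] never leads above [D]. *)
Lemma potential_invariant {n : nat} (z : nat -> Vec n) (kappa s alpha beta D : R) (L : nat)
  (x x' : nat -> Vec n) (rho : nat -> R) :
  0 < alpha <= 1 / 4 -> 0 < beta < 1 -> 0 < kappa -> 0 < s ->
  Rpower (alpha * beta) (- s) = 2 -> / (alpha * beta) <= 2 ^ L ->
  2 * (INR L * Rpower (alpha * beta / (4 * kappa)) (- s)) <= D ->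
  (forall k, 0 < rho k) -> (forall k, rho (S k) = alpha * beta * rho k) ->
  (forall k, dist (x k) (x' k) <= rho k / 2) ->
  (forall k, good_move z kappa s alpha (x k) (rho k) (x' k)) ->
  (forall k, rho (S k) + dist (x' k) (x (S k)) <= alpha * rho k) ->
  (forall J, potential z kappa s J (x O) (rho O) <= D) ->
  forall k J, (forall j, (J <= j)%nat -> ~ active kappa j (rho k)) ->
    potential z kappa s J (x k) (rho k) <= D.
Proof.
  intros Ha Hb Hk Hs Hab HL HD Hpos Hrho Hd Hg Hd' H0 k.
  induction k as [|k IH]; intros J HJ; [apply H0|].
  (* Radii decrease, so a truncation past the families active at turn [k + 1] is also past those
     active at turn [k]. *)
  assert (HJ' : forall j, (J <= j)%nat -> ~ active kappa j (rho k)).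
  { intros j Hj Hact; apply (HJ j Hj); unfold active in *.
    rewrite Hrho; specialize (Hpos k).
    assert (0 < 2 ^ j) by (apply pow_lt; lra).
    assert (0 < kappa * 2 ^ j * rho k) by (repeat apply Rmult_lt_0_compat; lra).
    assert (alpha * beta <= 1) by nra; nra. }
  specialize (IH J HJ').
  pose proof (potential_step z kappa s alpha beta L J (x k) (x' k) (x (S k)) (rho k)
                Ha Hb Hk Hs (Hpos k) Hab HL (Hd k) (Hg k)) as Hst.
  rewrite <- Hrho in Hst; specialize (Hst (Hd' k) HJ'); lra.
Qed.

(* Once [2^j rho_k] is below the threshold [eta], the weight of [j] exceeds the bound [D] on the
   potential, so that the ball is far from all hyperplanes [z_j . y = p]. *)
Lemma potential_bound_avoids {n : nat} (z : nat -> Vec n) (kappa s r D : R)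
  (x : nat -> Vec n) (rho : nat -> R) :
  0 < kappa -> 0 < s -> 0 < r < 1 -> 0 <= D ->
  (forall j, 2 ^ j <= 2 * norm (z j)) ->
  (forall k, rho k = rho O * r ^ k) -> 0 < rho O ->
  (forall k J, (forall j, (J <= j)%nat -> ~ active kappa j (rho k)) ->
    potential z kappa s J (x k) (rho k) <= D) ->
  exists delta, 0 < delta /\ forall y, (forall k, dist (x k) y <= rho k) ->
    forall j (p : Z), delta <= Rabs (dot (z j) y - IZR p).
Proof.
  intros Hk Hs Hr HD Hz Hrho Hrho0 Hpot.
  (* At scale [eta0] a single family weighs [D + 1]; the minimum with [/ (4 * kappa)] ensures that
     it is active. *)
  set (eta0 := Rpower (D + 1) (- / s)).
  set (eta := Rmin eta0 (/ (4 * kappa))).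
  assert (Heta0 : 0 < eta0) by apply exp_pos.
  assert (Hk4 : 0 < / (4 * kappa)) by (apply Rinv_0_lt_compat; lra).
  assert (Heta : 0 < eta) by (unfold eta; apply Rmin_pos; assumption).
  assert (Hpow : Rpower eta0 (- s) = D + 1).
  { unfold eta0; rewrite Rpower_mult.
    replace (- / s * - s) with 1 by (field; lra); apply Rpower_1; lra. }
  (* At the first [k] with [2 ^ j * rho k <= eta], the left side exceeds [eta * r], or is at least
     [rho O] if [k = 0]. The margin left at [y] is [rho k * norm (z j)], and
     [norm (z j) >= 2 ^ j / 2] accounts for the half. *)
  exists (Rmin (eta * r) (rho O) / 2); split.
  { assert (0 < Rmin (eta * r) (rho O)) by (apply Rmin_pos; nra); lra. }
  intros y Hy j p.
  assert (H2j : 1 <= 2 ^ j) by (apply pow_R1_Rle; lra).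
  assert (Hex : exists k, 2 ^ j * rho k <= eta).
  { destruct (pow_lt_1_zero r) with (y := eta / (2 ^ j * rho O)) as [N HN].
    - rewrite Rabs_right; lra.
    - apply Rdiv_lt_0_compat; nra.
    - exists N; specialize (HN N (Nat.le_refl N)).
      rewrite Rabs_right in HN by (apply Rle_ge, pow_le; lra).
      rewrite Hrho; apply (Rmult_lt_compat_l (2 ^ j * rho O)) in HN; [|nra].
      replace (2 ^ j * rho O * (eta / (2 ^ j * rho O))) with eta in HN by (field; lra).
      lra. }
  destruct (ex_first _ Hex) as [k [Hk1 Hmin]].
  assert (Hrk : 0 < rho k) by (rewrite Hrho; apply Rmult_lt_0_compat; [|apply pow_lt]; lra).
  assert (Hlow : Rmin (eta * r) (rho O) <= 2 ^ j * rho k).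
  { destruct k as [|k].
    - apply Rle_trans with (1 := Rmin_r _ _); nra.
    - apply Rle_trans with (1 := Rmin_l _ _).
      assert (H1 : eta < 2 ^ j * rho k) by (apply Rnot_le_lt, Hmin; lia).
      rewrite Hrho in H1 |- *; simpl; nra. }
  assert (Hact : active kappa j (rho k)).
  { unfold active; pose proof (Rmin_r eta0 (/ (4 * kappa))) as Hle; fold eta in Hle.
    replace (1 / 4) with (kappa * / (4 * kappa)) by (field; lra).
    rewrite Rmult_assoc; apply Rmult_le_compat_l; lra. }
  assert (Hfar : ~ near_integer (z j) (2 * rho k) (x k)).
  { intros Hnear; destruct (inactive_threshold kappa (rho k) Hk Hrk) as [J HJ].
    pose proof (Hpot k J HJ) as Hle.
    assert (HjJ : (j < J)%nat).
    { apply Nat.nle_gt; intros Hle'; exact (HJ j Hle' Hact). }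
    pose proof (nsum_ge_term
      (fun j => weight kappa s j (rho k) * ind (near_integer (z j) (2 * rho k) (x k))) J j) as Ht.
    lapply Ht; [clear Ht; intros Ht; specialize (Ht HjJ); simpl in Ht|].
    - rewrite (ind_true _ Hnear), (weight_active _ _ _ _ Hact) in Ht.
      assert (Rpower eta0 (- s) <= Rpower (2 ^ j * rho k) (- s)).
      { apply Rpower_neg_anti; [nra | | exact Hs].
        apply Rle_trans with (1 := Hk1), Rmin_l. }
      unfold potential in Hle; lra.
    - intros i; apply Rmult_le_pos; [apply weight_nonneg | apply ind_bounds]. }
  assert (Hp : 2 * rho k * norm (z j) < Rabs (dot (z j) (x k) - IZR p)).
  { apply Rnot_le_lt; intros H; apply Hfar; exists p; exact H. }
  pose proof (dot_dist n (z j) (x k) y) as Hd.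
  pose proof (norm_nonneg n (z j)) as Hn0.
  assert (norm (z j) * dist (x k) y <= norm (z j) * rho k)
    by (apply Rmult_le_compat_l; auto).
  pose proof (Rabs_triang (dot (z j) (x k) - dot (z j) y) (dot (z j) y - IZR p)) as T.
  replace (dot (z j) (x k) - dot (z j) y + (dot (z j) y - IZR p))
    with (dot (z j) (x k) - IZR p) in T by ring.
  specialize (Hz j); nra.
Qed.

Lemma half_life_exponent (r : R) : 0 < r < 1 -> exists s, 0 < s /\ Rpower r (- s) = 2.
Proof.
  intros Hr.
  assert (Hln : ln r < 0) by (rewrite <- ln_1; apply ln_increasing; lra).
  assert (Hln2 : 0 < ln 2) by (rewrite <- ln_1; apply ln_increasing; lra).
  exists (ln 2 / - ln r); split; [apply Rdiv_lt_0_compat; lra|].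
  unfold Rpower; replace (- (ln 2 / - ln r) * ln r) with (ln 2) by (field; lra).
  apply exp_ln; lra.
Qed.

Theorem lacunary_winning {n : nat} (mu : (Vec n -> Prop) -> ER) (C gam rho0 alpha : R)
  (z : nat -> Vec n) (kappa : R) :
  is_borel_measure mu ->
  0 < rho0 ->
  decaying_below mu C gam rho0 ->
  0 < alpha <= 1 / 4 -> C * Rpower (4 * alpha) gam <= 1 / 8 ->
  0 < kappa -> (forall j, 2 ^ j <= 2 * norm (z j)) -> (forall j, norm (z j) <= kappa * 2 ^ j) ->
  alpha_winning (supp mu)
    (fun y => exists delta, 0 < delta /\
       forall j (p : Z), delta <= Rabs (dot (z j) y - IZR p)) alpha.
Proof.
  intros Hm Hrho0 Hdec Ha HC Hk Hz1 Hz2 beta Hb.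
  assert (Hz : forall j, 0 < norm (z j) <= kappa * 2 ^ j).
  { intros j; split; [|apply Hz2]; specialize (Hz1 j).
    assert (0 < 2 ^ j) by (apply pow_lt; lra); lra. }
  assert (Hab : 0 < alpha * beta < 1) by nra.
  destruct (half_life_exponent _ Hab) as [s [Hs Hs2]].
  destruct (choice_fun (fun (w : Ball n) x' => supp mu (fst w) -> 0 < snd w ->
    supp mu x' /\ dist (fst w) x' <= snd w / 2 /\
    (snd w < rho0 -> good_move z kappa s alpha (fst w) (snd w) x'))) as [pick Hpick].
  { intros [x rho]; simpl.
    destruct (classic (supp mu x /\ 0 < rho < rho0)) as [[Hx Hr]|Hno].
    - destruct (good_move_exists mu C gam rho0 alpha z kappa s x rho) as [x' Hx']; auto.
      exists x'; tauto.
    - exists x; intros Hx Hr; rewrite dist_refl; repeat split; [exact Hx | lra | tauto]. }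
  set (strat := fun l : list (Ball n) =>
    let w := last l (fun _ => 0, 0) in (pick w, alpha * snd w)).
  assert (Hmove : forall b k, alice_move strat b k = (pick (b k), alpha * snd (b k))).
  { intros b k; unfold alice_move, strat; rewrite last_bob_prefix; reflexivity. }
  assert (Hbob : forall b k, (forall j, (j <= k)%nat -> bob_legal (supp mu) beta strat b j) ->
            supp mu (fst (b k)) /\ snd (b k) = snd (b O) * (alpha * beta) ^ k /\ 0 < snd (b O)).
  { intros b; induction k as [|k IH]; intros Hl.
    - destruct (Hl O (Nat.le_refl 0)) as [H1 H2]; simpl; repeat split; [exact H1 | ring | exact H2].
    - destruct IH as [_ [H2 H3]]; [intros j Hj; apply Hl; lia|].
      destruct (Hl (S k) (Nat.le_refl _)) as [H4 [H5 _]].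
      rewrite Hmove in H5; simpl in H5; repeat split; [exact H4 | | exact H3].
      rewrite H5, H2; simpl; ring. }
  exists strat; intros b; split.
  - intros k Hl; destruct (Hbob b k Hl) as [H1 [H2 H3]].
    assert (Hpos : 0 < snd (b k))
      by (rewrite H2; apply Rmult_lt_0_compat; [|apply pow_lt]; lra).
    destruct (Hpick (b k) H1 Hpos) as [H4 [H5 _]].
    unfold alice_legal; rewrite Hmove; simpl; repeat split; [exact H4|].
    unfold ball_le; simpl; nra.
  - intros Hl y Hy.
    assert (HB := fun k => Hbob b k (fun j _ => Hl j)).
    assert (Hr0 : 0 < snd (b O)) by apply (HB O).
    assert (Hrad : forall k, snd (b k) = snd (b O) * (alpha * beta) ^ k) by apply HB.
    assert (Hpos : forall k, 0 < snd (b k)).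
    { intros k; rewrite Hrad; apply Rmult_lt_0_compat; [|apply pow_lt]; lra. }
    (* The potential is followed from turn [t] on, when all radii are below [rho0]; its value there
       is finite and enters the bound as [D0]. *)
    destruct (pow_lt_1_zero (alpha * beta)) with (y := rho0 / snd (b O)) as [t Ht].
    { rewrite Rabs_right; lra. }
    { apply Rdiv_lt_0_compat; lra. }
    assert (Hsmall : forall k, snd (b (t + k)%nat) < rho0).
    { intros k; assert (Hk' : (t + k >= t)%nat) by lia; specialize (Ht _ Hk').
      rewrite Rabs_right in Ht by (apply Rle_ge, pow_le; lra).
      rewrite Hrad; apply (Rmult_lt_compat_l (snd (b O))) in Ht; [|lra].
      replace (snd (b O) * (rho0 / snd (b O))) with rho0 in Ht by (field; lra); exact Ht. }
    set (x := fun k => fst (b (t + k)%nat)); set (rho := fun k => snd (b (t + k)%nat)).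
    destruct (pow2_unbounded (/ (alpha * beta))) as [L HL].
    destruct (potential_bounded_at z kappa s (x O) (rho O) Hk Hs (Hpos _)) as [D0 HD0].
    set (LW := INR L * Rpower (alpha * beta / (4 * kappa)) (- s)).
    assert (HLW : 0 <= LW)
      by (apply Rmult_le_pos; [apply pos_INR | apply Rlt_le, exp_pos]).
    assert (HD : 0 <= Rmax D0 (2 * LW)) by (apply Rle_trans with (2 := Rmax_r _ _); lra).
    destruct (potential_bound_avoids z kappa s (alpha * beta) (Rmax D0 (2 * LW)) x rho)
      as [delta [Hdelta Havoid]]; auto; unfold rho.
    + intros k; rewrite (Hrad (t + k)%nat), (Hrad (t + 0)%nat), Nat.add_0_r, pow_add; ring.
    + apply Hpos.
    + apply (potential_invariant z kappa s alpha beta (Rmax D0 (2 * LW)) L x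
               (fun k => pick (b (t + k)%nat)) rho); auto; unfold rho, x.
      * lra.
      * apply Rmax_r.
      * intros k; apply Hpos.
      * intros k; rewrite (Hrad (t + S k)%nat), (Hrad (t + k)%nat), Nat.add_succ_r; simpl; ring.
      * intros k; apply Hpick; auto; apply HB.
      * intros k; apply Hpick; auto; apply HB.
      * intros k; rewrite Nat.add_succ_r.
        destruct (Hl (S (t + k))) as [_ [_ Hle]]; rewrite Hmove in Hle; exact Hle.
      * intros J; apply Rle_trans with D0; [apply HD0 | apply Rmax_l].
    + split; [|apply (Hy O)].
      exists delta; split; [exact Hdelta|].
      apply Havoid; intros k; apply (Hy (t + k)%nat).
Qed.

(** * Dirichlet's theorem and best approximations in dyadic shells *)

Definition fcons {A : Type} {n : nat} (p : A * (Fin.t n -> A)) (i : Fin.t (S n)) : A :=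
  Fin.caseS' i (fun _ => A) (fst p) (snd p).

Fixpoint list_funs {A : Type} (l : list A) (n : nat) : list (Fin.t n -> A) :=
  match n with
  | O => (fun i => Fin.case0 (fun _ => A) i) :: nil
  | S m => map fcons (list_prod l (list_funs l m))
  end.

Lemma fcons_eta {A : Type} {n : nat} (f : Fin.t (S n) -> A) :
  fcons (f Fin.F1, fun i => f (Fin.FS i)) = f.
Proof. extensionality i; apply (Fin.caseS' i); reflexivity. Qed.

Lemma In_list_funs {A : Type} (l : list A) (n : nat) (f : Fin.t n -> A) :
  In f (list_funs l n) <-> forall i, In (f i) l.
Proof.
  induction n as [|n IH]; simpl.
  - split.
    + intros _ i; inversion i.
    + intros _; left; extensionality i; inversion i.
  - rewrite in_map_iff; split.
    + intros [[a g] [<- Hin]] i; apply in_prod_iff in Hin; destruct Hin as [Ha Hg].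
      apply (Fin.caseS' i); simpl; [exact Ha | apply IH; exact Hg].
    + intros H; exists (f Fin.F1, fun i => f (Fin.FS i)); split; [apply fcons_eta|].
      apply in_prod; [apply H | apply IH; intros i; apply H].
Qed.

Lemma NoDup_list_prod {A B : Type} (l : list A) (l' : list B) :
  NoDup l -> NoDup l' -> NoDup (list_prod l l').
Proof.
  intros Hl Hl'; induction Hl as [|a l Ha Hl IH]; simpl; [constructor|].
  apply NoDup_app.
  - apply FinFun.Injective_map_NoDup; [|exact Hl'].
    intros b b' E; congruence.
  - exact IH.
  - intros [a' b] H1 H2; apply in_map_iff in H1; destruct H1 as [b' [E _]].
    apply in_prod_iff in H2; destruct H2 as [H2 _]; congruence.
Qed.

Lemma NoDup_list_funs {A : Type} (l : list A) (n : nat) :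
  NoDup l -> NoDup (list_funs l n).
Proof.
  intros Hl; induction n as [|n IH]; simpl.
  - constructor; [intros [] | constructor].
  - apply FinFun.Injective_map_NoDup; [|apply NoDup_list_prod; assumption].
    intros [a f] [b g] H; f_equal.
    + exact (f_equal (fun h => h Fin.F1) H).
    + extensionality i; exact (f_equal (fun h => h (Fin.FS i)) H).
Qed.

Lemma length_list_funs {A : Type} (l : list A) (n : nat) :
  length (list_funs l n) = (length l ^ n)%nat.
Proof.
  induction n as [|n IH]; simpl; [reflexivity|].
  rewrite length_map, length_prod, IH; reflexivity.
Qed.

Lemma pigeonhole_lists {A B : Type} (f : A -> B) (l : list A) (l' : list B) :
  NoDup l -> (forall a, In a l -> In (f a) l') -> (length l' < length l)%nat ->
  exists a a', In a l /\ In a' l /\ a <> a' /\ f a = f a'.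
Proof.
  intros Hl Hf Hlen; apply NNPP; intros Hn.
  assert (Hnd : NoDup (map f l)).
  { apply NoDup_map_NoDup_ForallPairs; [|exact Hl].
    intros a a' Ha Ha' E; apply NNPP; intros Hne; apply Hn; exists a, a'; tauto. }
  apply (NoDup_incl_length (l' := l')) in Hnd.
  - rewrite length_map in Hnd; lia.
  - intros b Hb; apply in_map_iff in Hb; destruct Hb as [a [<- Ha]]; auto.
Qed.

(** The vector [A^T y]. *)
Definition trmatZ {n m : nat} (A : Fin.t n -> Fin.t m -> R) (y : Fin.t n -> Z) : Vec m :=
  fun j => sumFin n (fun i => A i j * IZR (y i)).

(* The bound is [1 / (M + 1)], so that it is meaningful for [M = 0]. *)
Definition approximates {n m : nat} (A : Fin.t n -> Fin.t m -> R) (M : nat)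
  (y : Fin.t n -> Z) : Prop :=
  exists P : Fin.t m -> Z, forall j, Rabs (trmatZ A y j - IZR (P j)) <= / INR (S M).

(** Cuts [[0, 1)] into [M + 1] equal cells; the integer part is the index of the cell containing
    [frac_part v]. *)
Lemma frac_part_cell (M : nat) (v : R) :
  (Z.to_nat (Int_part (INR (S M) * frac_part v)) < S M)%nat /\
  INR (Z.to_nat (Int_part (INR (S M) * frac_part v))) <= INR (S M) * frac_part v
  < INR (Z.to_nat (Int_part (INR (S M) * frac_part v))) + 1.
Proof.
  destruct (base_fp v) as [H1 H2].
  assert (HM : 0 < INR (S M)) by (apply lt_0_INR; lia).
  set (u := INR (S M) * frac_part v).
  assert (Hu : 0 <= u < INR (S M)) by (unfold u; split; nra).
  destruct (base_Int_part u) as [H3 H4].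
  assert (H5 : (0 <= Int_part u)%Z).
  { apply Z.lt_succ_r, lt_IZR; rewrite succ_IZR; lra. }
  rewrite INR_IZR_INZ, Z2Nat.id by exact H5.
  split; [|lra].
  apply INR_lt; rewrite INR_IZR_INZ, Z2Nat.id by exact H5; lra.
Qed.

(** Pigeonhole: [(T + 1) ^ n] vectors with entries from 0 to [T] fall into [(M + 1) ^ m] cells, and
    [y] is the difference of two vectors in one cell. *)
Lemma Dirichlet_linear_forms {n m : nat} (A : Fin.t n -> Fin.t m -> R) (M T : nat) :
  (S M ^ m < S T ^ n)%nat ->
  exists y : Fin.t n -> Z, (exists i, y i <> 0%Z) /\
    (forall i, (Z.abs (y i) <= Z.of_nat T)%Z) /\ approximates A M y.
Proof.
  intros Hlt.
  set (cell := fun y : Fin.t n -> nat =>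
    fun j => Z.to_nat (Int_part (INR (S M) * frac_part (trmatZ A (fun i => Z.of_nat (y i)) j)))).
  destruct (pigeonhole_lists cell (list_funs (seq 0 (S T)) n) (list_funs (seq 0 (S M)) m))
    as [y [y' [Hy [Hy' [Hne Heq]]]]].
  - apply NoDup_list_funs, seq_NoDup.
  - intros y _; apply In_list_funs; intros j; apply in_seq.
    pose proof (frac_part_cell M (trmatZ A (fun i => Z.of_nat (y i)) j)) as [H _].
    unfold cell; lia.
  - rewrite !length_list_funs, !length_seq; exact Hlt.
  - exists (fun i => (Z.of_nat (y i) - Z.of_nat (y' i))%Z); repeat split.
    + apply NNPP; intros Hn; apply Hne; extensionality i.
      apply NNPP; intros Hi; apply Hn; exists i; lia.
    + intros i; rewrite In_list_funs in Hy, Hy'.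
      specialize (Hy i); specialize (Hy' i); apply in_seq in Hy; apply in_seq in Hy'; lia.
    + set (v := trmatZ A (fun i => Z.of_nat (y i))).
      set (v' := trmatZ A (fun i => Z.of_nat (y' i))).
      exists (fun j => (Int_part (v j) - Int_part (v' j))%Z); intros j.
      replace (trmatZ A _ j) with (v j - v' j).
      2: { unfold v, v', trmatZ.
           replace (sumFin n (fun i => A i j * IZR (Z.of_nat (y i) - Z.of_nat (y' i))))
             with (sumFin n (fun i => A i j * IZR (Z.of_nat (y i))
                                      + (-1) * (A i j * IZR (Z.of_nat (y' i))))).
           - rewrite sumFin_plus, sumFin_scal; ring.
           - apply sumFin_ext; intros i; rewrite minus_IZR; ring. }
      pose proof (frac_part_cell M (v j)) as [_ H1].
      pose proof (frac_part_cell M (v' j)) as [_ H2].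
      pose proof (f_equal (fun c => INR (c j)) Heq) as H3; unfold cell in H3; fold v v' in H3.
      rewrite <- H3 in H2.
      assert (HM : 0 < INR (S M)) by (apply lt_0_INR; lia).
      replace (v j - v' j - IZR (Int_part (v j) - Int_part (v' j)))
        with (frac_part (v j) - frac_part (v' j)) by (unfold frac_part; rewrite minus_IZR; ring).
      assert (E : / INR (S M) * INR (S M) = 1) by (field; lra).
      apply Rabs_le; split; apply Rmult_le_reg_r with (INR (S M)); lra.
Qed.

Lemma approximates_anti {n m : nat} (A : Fin.t n -> Fin.t m -> R) (M M' : nat)
  (y : Fin.t n -> Z) : (M <= M')%nat -> approximates A M' y -> approximates A M y.
Proof.
  intros HM [P HP]; exists P; intros j.
  apply Rle_trans with (1 := HP j), Rinv_le_contravar; [apply lt_0_INR; lia | apply le_INR; lia].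
Qed.

(** The levels [M] reached by an element form an initial segment, so any two elements are comparable
    and a finite list has a best one. *)
Lemma best_in_list {X : Type} (S : X -> Prop) (P : nat -> X -> Prop) (l : list X) :
  (forall M M' x, (M <= M')%nat -> P M' x -> P M x) -> (exists x, In x l /\ S x) ->
  exists z, S z /\ forall M y, In y l -> S y -> P M y -> P M z.
Proof.
  intros Hanti; induction l as [|a l IH]; intros [x [Hx HS]]; [destruct Hx|].
  destruct (classic (S a)) as [HSa|HSa].
  - destruct (classic (exists x, In x l /\ S x)) as [Hl|Hl].
    + destruct (IH Hl) as [z [Hz Hbest]].
      destruct (classic (forall M, P M a -> P M z)) as [Hcmp|Hcmp].
      * exists z; split; [exact Hz|]; intros M y [<-|Hy]; eauto.
      * apply not_all_ex_not in Hcmp; destruct Hcmp as [M0 H0].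
        apply imply_to_and in H0; destruct H0 as [H1 H2].
        (* [a] reaches level [M0] and [z] does not. An element of the tail reaching a level above
           [M0] would carry [z] past [M0], as [z] is best there. *)
        exists a; split; [exact HSa|]; intros M y [<-|Hy] HSy HPy; [exact HPy|].
        apply (Hanti M M0); [|exact H1].
        destruct (le_lt_dec M M0) as [H|H]; [exact H|].
        exfalso; apply H2, (Hanti M0 M); [lia | eauto].
    + exists a; split; [exact HSa|]; intros M y [<-|Hy] HSy HPy; [exact HPy|].
      exfalso; apply Hl; exists y; tauto.
  - destruct IH as [z [Hz Hbest]].
    { destruct Hx as [<-|Hx]; [contradiction | exists x; tauto]. }
    exists z; split; [exact Hz|]; intros M y [<-|Hy]; [contradiction | eauto].
Qed.

(** The lower bound [2 ^ (j - 1)] on the largest entry is doubled to remain an integer for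
    [j = 0]. *)
Definition shell {n : nat} (j : nat) (y : Fin.t n -> Z) : Prop :=
  (forall i, (Z.abs (y i) <= 2 ^ Z.of_nat j)%Z) /\
  exists i, (2 ^ Z.of_nat j <= 2 * Z.abs (y i))%Z.

Lemma shell_cover {n : nat} (k : nat) (y : Fin.t n -> Z) :
  (exists i, y i <> 0%Z) -> (forall i, (Z.abs (y i) <= 2 ^ Z.of_nat k)%Z) ->
  exists j, (j <= k)%nat /\ shell j y.
Proof.
  intros Hy; induction k as [|k IH]; intros Hk.
  - exists O; split; [lia|]; split; [exact Hk|].
    destruct Hy as [i Hi]; exists i; change (2 ^ Z.of_nat 0)%Z with 1%Z; lia.
  - destruct (classic (exists i, (2 ^ Z.of_nat (S k) <= 2 * Z.abs (y i))%Z)) as [He|He].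
    + exists (S k); split; [lia | split; assumption].
    + destruct IH as [j [Hj Hs]].
      * intros i; apply Z.lt_le_incl, Z.nle_gt; intros Hle; apply He; exists i.
        rewrite Nat2Z.inj_succ, Z.pow_succ_r by lia; lia.
      * exists j; split; [lia | exact Hs].
Qed.

(** A shell is nonempty and lies in a finite box. Closeness is compared only through the levels
    [1 / (M + 1)], so that [best_in_list] applies. *)
Lemma shell_best_approximation {n m : nat} (A : Fin.t n -> Fin.t m -> R) (j : nat) :
  (1 <= n)%nat ->
  exists z, shell j z /\ forall M y, shell j y -> approximates A M y -> approximates A M z.
Proof.
  intros Hn; set (N := (2 ^ Z.of_nat j)%Z).
  assert (HN : (0 < N)%Z) by (apply Z.pow_pos_nonneg; lia).
  set (l := list_funs (map (fun k => (Z.of_nat k - N)%Z) (seq 0 (Z.to_nat (2 * N + 1)))) n).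
  assert (Hl : forall y, shell j y -> In y l).
  { intros y [Hy _]; apply In_list_funs; intros i; apply in_map_iff.
    specialize (Hy i); fold N in Hy.
    exists (Z.to_nat (y i + N)); split; [lia | apply in_seq; lia]. }
  destruct (best_in_list (shell j) (approximates A) l) as [z [Hz Hbest]].
  - intros M M' y; apply approximates_anti.
  - assert (Hs : @shell n j (fun _ => N)).
    { split; [intros i; fold N; lia|].
      destruct n as [|n]; [lia|]; exists Fin.F1; fold N; lia. }
    exists (fun _ => N); auto.
  - exists z; split; [exact Hz|]; intros M y Hy; apply Hbest; auto.
Qed.

Lemma IZR_pow2 (j : nat) : IZR (2 ^ Z.of_nat j) = 2 ^ j.
Proof. symmetry; apply pow_IZR. Qed.

Lemma shell_norm {n : nat} (j : nat) (y : Fin.t n -> Z) : shell j y ->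
  2 ^ j <= 2 * norm (fun i => IZR (y i)) /\ norm (fun i => IZR (y i)) <= INR n * 2 ^ j.
Proof.
  intros [H1 [i Hi]]; rewrite <- IZR_pow2; split.
  - apply Rle_trans with (2 * IZR (Z.abs (y i))).
    + rewrite <- mult_IZR; apply IZR_le, Hi.
    + rewrite abs_IZR; pose proof (norm_ge_coord n (fun i => IZR (y i)) i); simpl in *; lra.
  - apply norm_le_coord; [apply IZR_le; lia|].
    intros k; rewrite <- abs_IZR; apply IZR_le, H1.
Qed.

(** * From avoiding hyperplanes to bad approximability *)

(** Swapping the double sum gives [q . (A^T y) = y . (A q)]; these terms cancel, and what is left
    besides [y . x] is the integer [N = q . P - y . p]. *)
Lemma transference {n m : nat} (A : Fin.t n -> Fin.t m -> R) (x : Vec n)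
  (q : Fin.t m -> Z) (p y : Fin.t n -> Z) (P : Fin.t m -> Z) :
  exists N : Z, dot (fun i => IZR (y i)) x - IZR N =
    sumFin m (fun j => IZR (q j) * (trmatZ A y j - IZR (P j)))
    - dot (fun i => IZR (y i)) (fun i => matZ A q i - x i - IZR (p i)).
Proof.
  destruct (sumFin_IZR m (fun j => (q j * P j)%Z)) as [N1 HN1].
  destruct (sumFin_IZR n (fun i => (y i * p i)%Z)) as [N2 HN2].
  exists (N1 - N2)%Z; rewrite minus_IZR, <- HN1, <- HN2.
  assert (E : sumFin m (fun j => IZR (q j) * trmatZ A y j)
              = sumFin n (fun i => IZR (y i) * matZ A q i)).
  { unfold trmatZ, matZ.
    transitivity (sumFin m (fun j => sumFin n (fun i => IZR (y i) * (A i j * IZR (q j))))).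
    - apply sumFin_ext; intros j; rewrite <- sumFin_scal; apply sumFin_ext; intros i; ring.
    - rewrite <- sumFin_swap; apply sumFin_ext; intros i; rewrite <- sumFin_scal; reflexivity. }
  replace (sumFin m (fun j => IZR (q j) * (trmatZ A y j - IZR (P j))))
    with (sumFin m (fun j => IZR (q j) * trmatZ A y j)
          + (-1) * sumFin m (fun j => IZR (q j * P j))).
  2: { rewrite <- sumFin_scal, <- sumFin_plus; apply sumFin_ext; intros j.
       rewrite mult_IZR; ring. }
  rewrite E; unfold dot.
  replace (sumFin n (fun i => IZR (y i) * (matZ A q i - x i - IZR (p i))))
    with (sumFin n (fun i => IZR (y i) * matZ A q i)
          + ((-1) * sumFin n (fun i => IZR (y i) * x i)
             + (-1) * sumFin n (fun i => IZR (y i * p i)))).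
  - ring.
  - rewrite <- !sumFin_scal, <- !sumFin_plus; apply sumFin_ext; intros i.
    rewrite mult_IZR; ring.
Qed.

Lemma znorm_norm {m : nat} (q : Fin.t m -> Z) : znorm q = norm (fun j => IZR (q j)).
Proof. reflexivity. Qed.

Lemma znorm_ge_1 {m : nat} (q : Fin.t m -> Z) : (exists j, q j <> 0%Z) -> 1 <= znorm q.
Proof.
  intros [j Hj]; rewrite znorm_norm.
  apply Rle_trans with (Rabs (IZR (q j))); [|apply (norm_ge_coord m (fun j => IZR (q j)))].
  rewrite <- abs_IZR; apply IZR_le; lia.
Qed.

Lemma dyadic_ceiling (B : R) : 1 <= B -> exists k, B <= 2 ^ k <= 2 * B.
Proof.
  intros HB; destruct (pow2_unbounded B) as [k0 Hk0].
  destruct (ex_first (fun k => B <= 2 ^ k)) as [k [Hk Hmin]]; [exists k0; lra|].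
  exists k; split; [exact Hk|]; destruct k as [|k]; [simpl; lra|].
  assert (2 ^ k < B) by (apply Rnot_le_lt, Hmin; lia); simpl; lra.
Qed.

Lemma Dirichlet_power {n m : nat} (A : Fin.t n -> Fin.t m -> R) (M : nat) :
  (1 <= n)%nat ->
  exists k y, 2 ^ k <= 2 * Rpower (INR (S M)) (INR m / INR n) /\ (exists i, y i <> 0%Z) /\
    (forall i, (Z.abs (y i) <= 2 ^ Z.of_nat k)%Z) /\ approximates A M y.
Proof.
  intros Hn; set (B := Rpower (INR (S M)) (INR m / INR n)).
  assert (HM : 1 <= INR (S M)) by (rewrite S_INR; pose proof (pos_INR M); lra).
  assert (HN : 0 < INR n) by (apply lt_0_INR; lia).
  assert (HB : 1 <= B).
  { unfold B; rewrite <- (Rpower_O (INR (S M))) by lra.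
    apply Rle_Rpower; [exact HM|]; apply Rle_mult_inv_pos; [apply pos_INR | exact HN]. }
  destruct (dyadic_ceiling B HB) as [k [Hk1 Hk2]].
  (* From [2 ^ k >= (M + 1)^(m/n)] follows [(M + 1) ^ m <= (2 ^ k) ^ n], and the extra value 0 of
     the entries makes the inequality strict. *)
  destruct (Dirichlet_linear_forms A M (2 ^ k)) as [y [Hy1 [Hy2 Hy3]]].
  - apply Nat.le_lt_trans with ((2 ^ k) ^ n)%nat; [|apply Nat.pow_lt_mono_l; lia].
    apply INR_le; rewrite !pow_INR; change (INR 2) with 2.
    rewrite <- (Rpower_pow m) by lra.
    apply Rle_trans with (B ^ n); [|apply pow_incr; lra].
    rewrite <- (Rpower_pow n) by lra; unfold B; rewrite Rpower_mult.
    apply Req_le; f_equal; field; lra.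
  - exists k, y; repeat split; auto.
    intros i; specialize (Hy2 i); rewrite Nat2Z.inj_pow in Hy2; exact Hy2.
Qed.

(** In the identity of [transference] for [z j] the left side is at least [delta]. A suitable [M]
    keeps the [q] term below [delta / 2], so the other half comes from [norm (z j) * norm err],
    where [norm (z j)] is of order at most [|q|^(m/n)]. *)
Lemma Bad_of_avoidance {n m : nat} (A : Fin.t n -> Fin.t m -> R) (z : nat -> Fin.t n -> Z)
  (x : Vec n) (delta : R) :
  (1 <= n)%nat -> (forall j, shell j (z j)) ->
  (forall j M y, shell j y -> approximates A M y -> approximates A M (z j)) ->
  0 < delta ->
  (forall j (p : Z), delta <= Rabs (dot (fun i => IZR (z j i)) x - IZR p)) ->
  Bad n m A x.
Proof.
  intros Hn Hsh Hbest Hdelta Havoid.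
  assert (HN : 0 < INR n) by (apply lt_0_INR; lia).
  set (e := INR m / INR n).
  assert (He : 0 <= e) by (apply Rle_mult_inv_pos; [apply pos_INR | exact HN]).
  set (c0 := 2 * INR m / delta + 1).
  assert (Hc0 : 1 <= c0).
  { assert (0 <= 2 * INR m / delta)
      by (apply Rle_mult_inv_pos; [pose proof (pos_INR m); lra | exact Hdelta]).
    unfold c0; lra. }
  set (G := Rpower c0 e).
  assert (HG : 0 < G) by apply exp_pos.
  assert (HNG : 0 < 4 * INR n * G) by (repeat apply Rmult_lt_0_compat; lra).
  exists (delta / (4 * INR n * G)); split; [apply Rdiv_lt_0_compat; lra|].
  intros q Hq p; set (Q := znorm q).
  assert (HQ : 1 <= Q) by (apply znorm_ge_1; exact Hq).
  (* [M + 1 = up u > u] makes the [q] term at most [m * Q / (M + 1) <= delta / 2]; and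
     [M + 1 <= u + 1 <= u + Q = c0 * Q], whence [c0]. *)
  set (u := 2 * INR m / delta * Q).
  assert (Hu : 0 <= u) by (unfold u, c0 in *; apply Rmult_le_pos; lra).
  destruct (archimed u) as [Hup1 Hup2].
  assert (Hup : (0 < up u)%Z) by (apply lt_IZR; lra).
  set (M := pred (Z.to_nat (up u))).
  assert (HM : INR (S M) = IZR (up u)).
  { rewrite INR_IZR_INZ; f_equal; unfold M; lia. }
  destruct (Dirichlet_power A M Hn) as [k [y [Hk [Hy0 [Hyk Hy]]]]].
  destruct (shell_cover k y Hy0 Hyk) as [j [Hj Hshj]].
  (* The Dirichlet vector [y] only serves to locate the shell; [z j] is as good at level [M]. *)
  destruct (Hbest j M y Hshj Hy) as [P HP].
  destruct (transference A x q p (z j) P) as [N HT].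
  specialize (Havoid j N); rewrite HT in Havoid.
  set (err := fun i => matZ A q i - x i - IZR (p i)) in *.
  change (dist (fun i => matZ A q i - x i) (fun i => IZR (p i))) with (norm err).
  fold e Q.
  pose proof (norm_nonneg n err) as Herr.
  assert (HS : 0 < INR (S M)) by lra.
  assert (T1 : Rabs (sumFin m (fun j0 => IZR (q j0) * (trmatZ A (z j) j0 - IZR (P j0))))
               <= delta / 2).
  { apply Rle_trans with (INR m * (Q * / INR (S M))).
    - apply Rabs_sumFin_le; intros i; rewrite Rabs_mult.
      apply Rmult_le_compat; try apply Rabs_pos; [|apply HP].
      apply (norm_ge_coord m (fun j => IZR (q j))).
    - apply Rmult_le_reg_r with (INR (S M)); [exact HS|].
      replace (INR m * (Q * / INR (S M)) * INR (S M)) with (delta / 2 * u)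
        by (unfold u; field; lra).
      apply Rmult_le_compat_l; lra. }
  pose proof (Cauchy_Schwarz n (fun i => IZR (z j i)) err) as T2.
  assert (T3 : norm (fun i => IZR (z j i)) <= INR n * (2 * (G * Rpower Q e))).
  { apply Rle_trans with (1 := proj2 (shell_norm j (z j) (Hsh j))).
    apply Rmult_le_compat_l; [lra|].
    apply Rle_trans with (2 ^ k); [apply Rle_pow; [lra | exact Hj]|].
    apply Rle_trans with (1 := Hk); apply Rmult_le_compat_l; [lra|].
    unfold G; rewrite Rpower_mult_distr by lra.
    apply Rle_Rpower_l; [exact He|]; split; [exact HS|].
    rewrite HM; apply Rle_trans with (u + Q); [lra|].
    unfold u, c0; lra. }
  assert (T4 : norm (fun i => IZR (z j i)) * norm err
               <= INR n * (2 * (G * Rpower Q e)) * norm err)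
    by (apply Rmult_le_compat_r; assumption).
  pose proof (Rabs_triang
    (sumFin m (fun j0 => IZR (q j0) * (trmatZ A (z j) j0 - IZR (P j0))))
    (- dot (fun i => IZR (z j i)) err)) as T5.
  rewrite Rabs_Ropp in T5.
  apply Rmult_le_reg_l with (4 * INR n * G); [exact HNG|].
  replace (4 * INR n * G * (delta / (4 * INR n * G))) with delta by (field; lra).
  unfold Rminus in *; lra.
Qed.

Lemma decay_scale (C gam : R) : 0 < C -> 0 < gam ->
  exists alpha, 0 < alpha <= 1 / 4 /\ C * Rpower (4 * alpha) gam <= 1 / 8.
Proof.
  intros HC Hg.
  assert (H8 : 0 < 1 / (8 * C)) by (apply Rdiv_lt_0_compat; lra).
  (* [a] solves [C * Rpower a gam = 1 / 8]. *)
  set (a := Rpower (1 / (8 * C)) (/ gam)).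
  assert (Ha : 0 < a) by apply exp_pos.
  exists (Rmin (1 / 4) (a / 4)); split.
  - split; [apply Rmin_pos; lra | apply Rmin_l].
  - pose proof (Rmin_r (1 / 4) (a / 4)) as Hr.
    assert (Hp : 0 < Rmin (1 / 4) (a / 4)) by (apply Rmin_pos; lra).
    apply Rle_trans with (C * Rpower a gam).
    + apply Rmult_le_compat_l; [lra|]; apply Rle_Rpower_l; lra.
    + unfold a; rewrite Rpower_mult, Rinv_l, Rpower_1 by lra.
      apply Req_le; field; lra.
Qed.

Lemma ab_winning_mono {n : nat} (K S S' : Vec n -> Prop) (alpha beta : R) :
  (forall x, S x -> S' x) -> ab_winning K S alpha beta -> ab_winning K S' alpha beta.
Proof.
  intros HS [s Hs]; exists s; intros b; destruct (Hs b) as [H1 H2]; split; [exact H1|].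
  intros Hl y Hy; destruct (H2 Hl y Hy); auto.
Qed.

Theorem corollary1p4 :
  forall (n : nat), (1 <= n)%nat ->
  forall (mu : (Vec n -> Prop) -> ER),
    is_borel_measure mu -> locally_finite mu -> abs_decaying mu ->
    exists alpha : R, 0 < alpha < 1 /\
      forall (m : nat) (A : Fin.t n -> Fin.t m -> R),
        alpha_winning (supp mu) (Bad n m A) alpha.
Proof.
  intros n Hn mu Hm _ [C [gam [HC [Hgam [rho0 [Hrho0 Hdec]]]]]].
  (* [alpha] comes from [C] and [gam] alone, hence before [m], [A] and [beta]. *)
  destruct (decay_scale C gam HC Hgam) as [alpha [Ha HCa]].
  exists alpha; split; [lra|]; intros m A beta Hb.
  destruct (choice_fun _ (fun j => shell_best_approximation A j Hn)) as [z Hz].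
  apply ab_winning_mono with (fun y => exists delta, 0 < delta /\
    forall j (p : Z), delta <= Rabs (dot (fun i => IZR (z j i)) y - IZR p)).
  - intros x [delta [Hd Havoid]].
    apply (Bad_of_avoidance A z x delta Hn); auto; intros j; apply Hz.
  - apply (lacunary_winning mu C gam rho0 alpha (fun j i => IZR (z j i)) (INR n)); auto.
    + apply lt_0_INR; lia.
    + intros j; apply shell_norm, Hz.
    + intros j; apply shell_norm, Hz.
Qed.
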